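(* Let $\mathcal{X}\subseteq\mathbb{R}^d$ be nonempty, closed and convex, let $V:\mathbb{R}^d\to\mathbb{R}^d$, and let $x^\star$ be a regular solution of the variational inequality associated with $V$ and $\mathcal{X}$. Then there are neighborhoods $U$ and $U_1$ of $x^\star$ in $\mathcal{X}$ with $$M=\sup_{x\in U}\|V(x)\|<\infty,\qquad \alpha=\inf_{x\in U,\,x\ne x^\star}\frac{\langle V(x),x-x^\star\rangle}{\|x-x^\star\|^2}>0,$$ such that for every tolerance level $\delta\in(0,1)$ and every $\gamma>1/\alpha$ the following holds for all large enough $b$. Suppose that the Past Extra-Gradient algorithm (PEG) of the context is run with stochastic oracle feedback, step-sizes $\gamma_t=\gamma/(t+b)$, and initialization $X_{1/2}\in U$, $X_1\in U_1$. Then: (a) The event $E_\infty=\{X_{t+1/2}\in U\text{ for all }t=1,2,\dots\}$ occurs with probability at least $1-\delta$. (b) Conditionally on $E_\infty$, as $t\to\infty$, $$\mathbb{E}\big[\|X_t-x^\star\|^2\mid E_\infty\big]\le\frac{4\gamma^2(M^2+\sigma^2)}{(\alpha\gamma-1)(1-\delta)}\,\frac1t+o\!\left(\frac1t\right).$$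
   Context: $\|\cdot\|$ is the Euclidean norm and $\Pi_{\mathcal{X}}$ the Euclidean projection onto $\mathcal{X}$. A solution of the variational inequality is a point $x^\star\in\mathcal{X}$ with $\langle V(x^\star),x-x^\star\rangle\ge0$ for all $x\in\mathcal{X}$. It is called regular if $V$ is $C^1$-smooth in a neighborhood of $x^\star$ and the Jacobian $\mathrm{Jac}_V(x^\star)$ satisfies $z^\top\mathrm{Jac}_V(x^\star)z>0$ for all nonzero $z\in\mathbb{R}^d$ tangent to $\mathcal{X}$ at $x^\star$, i.e. all nonzero $z$ in the (closed) tangent cone to $\mathcal{X}$ at $x^\star$. (PEG): starting from $X_{1/2},X_1\in\mathcal{X}$, for $t=1,2,\dots$, $$X_{t+1/2}=\Pi_{\mathcal{X}}(X_t-\gamma_tV_{t-1/2}),\qquad X_{t+1}=\Pi_{\mathcal{X}}(X_t-\gamma_tV_{t+1/2}).$$ Stochastic oracle: for $t=0,1,2,\dots$, $V_{t+1/2}=V(X_{t+1/2})+Z_{t+1/2}$, where the noise satisfies $\mathbb{E}[Z_{t+1/2}\mid\mathcal{F}_{t+1/2}]=0$ and $\mathbb{E}[\|Z_{t+1/2}\|^2\mid\mathcal{F}_{t+1/2}]\le\sigma^2$ for some $\sigma\ge0$. Here $\mathcal{F}_{t+1/2}$ is the history of the process up to the generation of $X_{t+1/2}$, before $Z_{t+1/2}$ is drawn: it is generated by $X_{1/2},X_1$ and the oracle outputs $V_{1/2},\dots,V_{t-1/2}$. *)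

(* Defs.v *)
From HB Require Import structures.
From mathcomp Require Export all_boot all_order all_algebra.
From mathcomp Require Export all_classical all_reals all_analysis.
Export Order.TTheory GRing.Theory Num.Theory.
Export numFieldNormedType.Exports.

Set Implicit Arguments.
Unset Strict Implicit.
Unset Printing Implicit Defensive.

Local Open Scope classical_set_scope.
Local Open Scope ring_scope.

Section Euclidean.
Context {R : realType} {d : nat}.
Implicit Types (u v x y p z : 'rV[R]_d) (X U : set 'rV[R]_d).

Definition dotv u v : R := \sum_(i < d) u ord0 i * v ord0 i.

(* The library norm `|u| on row vectors is the max norm (with the same
   topology), hence this separate Euclidean norm. *)
Definition enorm u : R := Num.sqrt (dotv u u).

(* p is the Euclidean projection of y onto X (unique when X is convex). *)
Definition is_eproj X y p := X p /\ forall x, X x -> enorm (y - p) <= enorm (y - x).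

Definition nbhd_in X x U := U `<=` X /\ within X (nbhs x) U.

Definition tangent_cone X x : set 'rV[R]_d :=
  closure [set z | exists c y, [/\ 0 <= c, X y & z = c *: (y - x)]].

End Euclidean.

Section VariationalInequality.
Context {R : realType} {d : nat}.
Variables (X : set 'rV[R]_d) (V : 'rV[R]_d -> 'rV[R]_d).

Definition VI_solution (xs : 'rV[R]_d) :=
  X xs /\ forall x, X x -> 0 <= dotv (V xs) (x - xs).

Definition C1_near (x : 'rV[R]_d) :=
  \forall y \near x, differentiable V y /\ {for y, continuous (jacobian V)}.

(* The library Jacobian acts on row vectors from the right, so it is the
   transpose of the usual one; the quadratic form is the same. *)
Definition regular_solution (xs : 'rV[R]_d) :=
  [/\ VI_solution xs, C1_near xs &
      forall z, tangent_cone X xs z -> z != 0 ->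
        0 < (z *m jacobian V xs *m z^T) ord0 ord0].

Definition sup_norm_on (U : set 'rV[R]_d) : \bar R :=
  ereal_sup [set (enorm (V x))%:E | x in U].

(* Equal to +oo when U is reduced to xs, i.e. when X is the singleton of xs. *)
Definition inf_curvature (U : set 'rV[R]_d) (xs : 'rV[R]_d) : \bar R :=
  ereal_inf [set (dotv (V x) (x - xs) / enorm (x - xs) ^+ 2)%:E
            | x in [set x | U x /\ x != xs]].

(* Xh t, Xs t and G t stand for X_{t+1/2}, X_t and V_{t+1/2}; the value Xs 0
   is unused. *)
Definition PEG (step : nat -> R) (Xh Xs G : nat -> 'rV[R]_d) :=
  [/\ X (Xh 0%N), X (Xs 1%N) &
      forall t, (0 < t)%N ->
        is_eproj X (Xs t - step t *: G t.-1) (Xh t) /\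
        is_eproj X (Xs t - step t *: G t) (Xs t.+1)].

End VariationalInequality.

Section Probability.
Context {R : realType} {d : nat} {disp : measure_display}
  {T : measurableType disp}.
Variable P : probability T R.

Definition random_vector (Y : T -> 'rV[R]_d) :=
  forall i, measurable_fun setT (fun w => Y w ord0 i).

Definition coord_events (Y : T -> 'rV[R]_d) : set (set T) :=
  \bigcup_(i : 'I_d)
    preimage_set_system setT (fun w => Y w ord0 i) (@measurable _ R).

(* Y is a version of the conditional expectation of X given the
   sigma-algebra F. *)
Definition is_cond_exp (F : set (set T)) (X Y : T -> R) :=
  [/\ P.-integrable setT (EFin \o X),
      P.-integrable setT (EFin \o Y),
      forall B, measurable B -> F (Y @^-1` B) &
      forall A, F A ->
        (\int[P]_(w in A) (X w)%:E = \int[P]_(w in A) (Y w)%:E)%E].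

Definition exp_given_event (A : set T) (X : T -> R) : \bar R :=
  (\int[P]_(w in A) (X w)%:E / P A)%E.

(* The sigma-algebra F_{t+1/2}, with the indexing of PEG. *)
Definition history (Xh Xs G : nat -> T -> 'rV[R]_d) (t : nat) : set (set T) :=
  <<s coord_events (Xh 0%N) `|` coord_events (Xs 1%N) `|`
      \bigcup_(k in `I_t) coord_events (G k) >>.

(* V itself need not be measurable: the oracle outputs G t and the noise
   vectors Z t are random vectors. *)
Definition stochastic_oracle (V : 'rV[R]_d -> 'rV[R]_d) (sigma : R)
    (Xh Xs G Z : nat -> T -> 'rV[R]_d) :=
  [/\ random_vector (Xh 0%N), random_vector (Xs 1%N) &
      forall t,
        [/\ random_vector (G t), random_vector (Z t),
            forall w, G t w = V (Xh t w) + Z t w,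
            forall i, is_cond_exp (history Xh Xs G t)
                        (fun w => Z t w ord0 i) (cst 0) &
            exists2 Y, is_cond_exp (history Xh Xs G t)
                         (fun w => enorm (Z t w) ^+ 2) Y &
                       {ae P, forall w, Y w <= sigma ^+ 2}]].

End Probability.

(* Main.v *)
Require Import Defs.
From mathcomp Require Import ring lra measurable_realfun.

Set Implicit Arguments.
Unset Strict Implicit.
Unset Printing Implicit Defensive.

Local Open Scope classical_set_scope.
Local Open Scope ring_scope.

(** Write p for the solution, D_t for the squared distance of X_t to p, g_t for
    the step-size, v_t for the squared norm of the oracle output V_{t+1/2}, and
    m_t for the inner product of the noise Z_{t+1/2} with X_{t+1/2} - p.

    At a regular solution the quadratic form of the Jacobian is positive on the
    unit vectors of the closed tangent cone, hence bounded below there by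
    compactness; by differentiability, <V(x), x - p> >= a |x - p|^2 for some
    a > 0 and all x of X close to p ([regular_local]). The sets U and U_1 are the
    traces on X of the Euclidean balls of center p and radii r and r / 3.

    The obtuse-angle property of projections, applied to both half-steps, gives
    [peg_descent]; for small steps and as long as X_{t-1/2} and X_{t+1/2} are in U,
    it yields ([sqd_step])
      D_{t+1} <= (1 - a g_t) D_t - 2 g_t m_t + 2 g_t^2 (v_t + v_{t-1}).
    On the event that the half-steps up to time t are in U, the oracle output
    has second moment at most M^2 + sigma^2, since the noise is orthogonal to
    bounded functions of the past ([Ex_adapted_mul], [Ex_gsq]).

    For (a), the distance D_1 is only bounded by a fixed fraction of r^2, so a
    first-moment bound on D_t is not enough to make the exit probability small.
    Let Q be the sum of the terms 2 g_s m_s, let R be the sum of the terms with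
    g_s^2, and let c = r^2 / 8. While (Q / c)^2 + R / c <= 1, the next half-step is
    in U ([good_stay]). The expectation of this quantity, stopped when it first
    exceeds one, grows at each step by at most a constant times g_t^2
    ([Ex_stopped_step]), as Q is a martingale. Thus the probability of ever
    leaving U is at most a constant times the sum of the g_t^2, which is O(1 / b)
    ([prob_stay], [sum_sqr_step_le]).

    For (b), taking expectations on the event that the half-steps up to time t
    are in U removes m_t from the recursion ([Ex_stopped_sqd_step]), and Chung's
    lemma ([chung]) gives the rate with its exact leading constant. Division by
    the probability of the event costs the factor 1 - delta. An infinite alpha
    means that X is the singleton of p ([curvature_pinfty]). *)

(** * Inner product and Euclidean projection *)

Section InnerProduct.
Context {R : realType} {d : nat}.
Implicit Types (u v w x y p : 'rV[R]_d) (X : set 'rV[R]_d) (a : R).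

Lemma dotvC u v : dotv u v = dotv v u.
Proof. by apply: eq_bigr => i _; rewrite mulrC. Qed.

Lemma dotvDl u v w : dotv (u + v) w = dotv u w + dotv v w.
Proof. by rewrite /dotv -big_split; apply: eq_bigr => i _; rewrite !mxE mulrDl. Qed.

Lemma dotvZl a u w : dotv (a *: u) w = a * dotv u w.
Proof. by rewrite /dotv mulr_sumr; apply: eq_bigr => i _; rewrite !mxE mulrA. Qed.

Lemma dotvNl u w : dotv (- u) w = - dotv u w.
Proof. by rewrite -scaleN1r dotvZl mulN1r. Qed.

Lemma dotvDr u v w : dotv w (u + v) = dotv w u + dotv w v.
Proof. by rewrite dotvC dotvDl !(dotvC _ w). Qed.

Lemma dotvZr a u w : dotv w (a *: u) = a * dotv w u.
Proof. by rewrite dotvC dotvZl dotvC. Qed.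

Lemma dotvNr u w : dotv w (- u) = - dotv w u.
Proof. by rewrite dotvC dotvNl dotvC. Qed.

Lemma dotv0 u : dotv u 0 = 0.
Proof. by rewrite -(scale0r 0) dotvZr mul0r. Qed.

(** Bilinear expansion. *)
Definition dotvE := (dotvDl, dotvDr, dotvNl, dotvNr, dotvZl, dotvZr).

Lemma dotv_ge0 u : 0 <= dotv u u.
Proof. by apply: sumr_ge0 => i _; rewrite -expr2 sqr_ge0. Qed.

Lemma enorm_ge0 u : 0 <= enorm u.
Proof. exact: sqrtr_ge0. Qed.

Lemma enorm_sqr u : enorm u ^+ 2 = dotv u u.
Proof. by rewrite sqr_sqrtr// dotv_ge0. Qed.

Lemma le_enorm u v : (enorm u <= enorm v) = (dotv u u <= dotv v v).
Proof. by rewrite -!enorm_sqr ler_sqr ?nnegrE ?enorm_ge0. Qed.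

Lemma dotv_eq0 u : (dotv u u == 0) = (u == 0).
Proof.
apply/idP/eqP => [|->]; last by rewrite dotv0.
rewrite psumr_eq0 => [|i _]; last by rewrite -expr2 sqr_ge0.
move=> /allP h; apply/rowP => i; rewrite mxE; apply/eqP.
by have := h i (mem_index_enum _); rewrite mulf_eq0 orbb.
Qed.

Lemma coord_sqr_le u i : u ord0 i ^+ 2 <= dotv u u.
Proof.
by rewrite /dotv (bigD1 i)//= -expr2 lerDl sumr_ge0// => j _; rewrite -expr2 sqr_ge0.
Qed.

Lemma dotv_subZ u v a :
  dotv (u - a *: v) (u - a *: v) = dotv u u - 2 * a * dotv u v + a ^+ 2 * dotv v v.
Proof. by rewrite !dotvE (dotvC v u); ring. Qed.

Lemma sqr_dotv_le u v : dotv u v ^+ 2 <= dotv u u * dotv v v.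
Proof.
have [/eqP|v0] := eqVneq (dotv v v) 0.
  by rewrite dotv_eq0 => /eqP ->; rewrite !dotv0 mulr0 expr0n.
have vp : 0 < dotv v v by rewrite lt0r v0 dotv_ge0.
have := dotv_ge0 (dotv v v *: u - dotv u v *: v).
have -> : dotv (dotv v v *: u - dotv u v *: v) (dotv v v *: u - dotv u v *: v)
    = dotv v v * (dotv u u * dotv v v - dotv u v ^+ 2).
  by rewrite !dotvE (dotvC v u); ring.
by rewrite pmulr_rge0// subr_ge0.
Qed.

Lemma dotv_AGM u v : 2 * dotv u v <= dotv u u + dotv v v.
Proof. by have := dotv_ge0 (u - v); rewrite !dotvE (dotvC v u); lra. Qed.

Lemma sqr_dotvB_le u v : dotv (u - v) (u - v) <= 2 * dotv u u + 2 * dotv v v.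
Proof. by have := dotv_ge0 (u + v); rewrite !dotvE (dotvC v u); lra. Qed.

Lemma sqr_dotvD_le u v : dotv (u + v) (u + v) <= 2 * dotv u u + 2 * dotv v v.
Proof. by have := dotv_ge0 (u - v); rewrite !dotvE (dotvC v u); lra. Qed.

Lemma mxnorm_coord_le u i : `|u ord0 i| <= `|u|.
Proof.
rewrite /Num.norm/= mx_normrE.
by apply: (le_trans _ (le_bigmax _ _ (ord0, i))) => /=.
Qed.

Lemma mxnorm_le u a : 0 <= a -> (forall i, `|u ord0 i| <= a) -> `|u| <= a.
Proof.
move=> a0 h; rewrite /Num.norm/= mx_normrE; apply: bigmax_le => // -[i j] _ /=.
by rewrite ord1.
Qed.

Lemma mxnorm_le_enorm u : `|u| <= enorm u.
Proof.
apply: mxnorm_le => [|i]; first exact: enorm_ge0.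
rewrite -ler_sqr ?nnegrE ?enorm_ge0//.
by rewrite real_normK ?num_real// enorm_sqr coord_sqr_le.
Qed.

Lemma dotv_le_mxnorm u : dotv u u <= d%:R * `|u| ^+ 2.
Proof.
have h i : u ord0 i * u ord0 i <= `|u| ^+ 2.
  by rewrite -expr2 -real_normK ?num_real// lerXn2r ?nnegrE// mxnorm_coord_le.
apply: (le_trans (ler_sum _ (fun i _ => h i))).
by rewrite sumr_const card_ord mulr_natl.
Qed.

Lemma convex_set_segment X x y t : convex_set (X : set (convex_lmodType 'rV[R]_d)) ->
  X x -> X y -> 0 <= t -> t <= 1 -> X (t *: x + (1 - t) *: y).
Proof.
move=> Xcv Xx Xy t0 t1.
have /set_mem := Xcv x y (Itv01 t0 t1) (mem_set Xx) (mem_set Xy).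
by [].
Qed.

(** Variational characterization of the projection onto a convex set. *)
Lemma eproj_obtuse X y p x : convex_set (X : set (convex_lmodType 'rV[R]_d)) ->
  is_eproj X y p -> X x -> dotv (y - p) (x - p) <= 0.
Proof.
move=> Xcv [Xp pmin] Xx; rewrite leNgt; apply/negP => h0.
set A := dotv (y - p) (x - p) in h0 *.
set B := dotv (x - p) (x - p).
have B0 : 0 <= B by exact: dotv_ge0.
(* moving from p towards x by a small t strictly decreases the distance to y *)
pose t := A / (A + B).
have AB : 0 < A + B by lra.
have t0 : 0 < t by rewrite divr_gt0.
have t1 : t <= 1 by rewrite ler_pdivrMr//; lra.
have Xq : X (t *: x + (1 - t) *: p).
  by apply: (convex_set_segment Xcv) => //; exact: ltW.
have := pmin _ Xq; rewrite le_enorm.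
have -> : y - (t *: x + (1 - t) *: p) = (y - p) - t *: (x - p).
  by apply/rowP => i; rewrite !mxE; ring.
have -> : dotv (y - p - t *: (x - p)) (y - p - t *: (x - p)) =
    dotv (y - p) (y - p) + t * (t * B - 2 * A).
  by rewrite dotv_subZ -/A -/B; ring.
rewrite lerDl pmulr_rge0// => tt.
suff : t * B <= A by lra.
by rewrite mulrAC ler_pdivrMr//; nra.
Qed.

Lemma eproj_nonexpansive X y y' p p' :
  convex_set (X : set (convex_lmodType 'rV[R]_d)) ->
  is_eproj X y p -> is_eproj X y' p' ->
  dotv (p - p') (p - p') <= dotv (y - y') (y - y').
Proof.
move=> Xcv hp hp'.
have h1 := eproj_obtuse Xcv hp hp'.1.
have h2 := eproj_obtuse Xcv hp' hp.1.
have := dotv_AGM (y - y') (p - p').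
have : dotv (y - y') (p - p') - dotv (p - p') (p - p') =
   - dotv (y - p) (p' - p) - dotv (y' - p') (p - p').
  by rewrite !dotvE; ring.
lra.
Qed.

(** One step of the past extra-gradient recursion, compared with a point [p]
    of the constraint set. *)
Lemma peg_descent X x h x' g g' p (a : R) :
  convex_set (X : set (convex_lmodType 'rV[R]_d)) -> X p ->
  is_eproj X (x - a *: g') h -> is_eproj X (x - a *: g) x' ->
  dotv (x' - p) (x' - p) <= dotv (x - p) (x - p) - 2 * a * dotv g (h - p)
    + a ^+ 2 * dotv (g - g') (g - g') - dotv (h - x) (h - x).
Proof.
move=> Xcv Xp hh hx'.
have h1 := eproj_obtuse Xcv hx' Xp.
have h2 := eproj_obtuse Xcv hh hx'.1.
have h3 := dotv_ge0 ((x' - h) + a *: (g - g')).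
rewrite -subr_ge0.
(* the gap is the sum of the two obtuse-angle terms and of a square *)
have -> : dotv (x - p) (x - p) - 2 * a * dotv g (h - p)
    + a ^+ 2 * dotv (g - g') (g - g') - dotv (h - x) (h - x) - dotv (x' - p) (x' - p)
  = - 2 * dotv (x - a *: g - x') (p - x') - 2 * dotv (x - a *: g' - h) (x' - h)
   + dotv ((x' - h) + a *: (g - g')) ((x' - h) + a *: (g - g')).
  rewrite !dotvE ?(dotvC h x) ?(dotvC x' x) ?(dotvC x' h) ?(dotvC g x)
    ?(dotvC g h) ?(dotvC g x') ?(dotvC g' x) ?(dotvC g' h) ?(dotvC g' x')
    ?(dotvC g' g) ?(dotvC p x) ?(dotvC p h) ?(dotvC p x') ?(dotvC p g)
    ?(dotvC p g').
  ring.
lra.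
Qed.

End InnerProduct.

(** * Regular solutions *)

Section Regularity.
Context {R : realType} {d : nat}.
Implicit Types (X : set 'rV[R]_d) (V : 'rV[R]_d -> 'rV[R]_d).

Lemma continuous_dotv (f g : 'rV[R]_d -> 'rV[R]_d) :
  (forall i, continuous (fun z => f z ord0 i)) ->
  (forall i, continuous (fun z => g z ord0 i)) ->
  continuous (fun z => dotv (f z) (g z)).
Proof.
move=> fc gc z; rewrite /dotv; apply: cvg_big; [exact: add_continuous|exact: nbhs_filter|].
by move=> i _; exact: (cvgM (fc i z) (gc i z)).
Qed.

Lemma continuous_mulmx_coord (A : 'M[R]_d) i :
  continuous (fun z : 'rV[R]_d => (z *m A) ord0 i).
Proof.
have -> : (fun z : 'rV[R]_d => (z *m A) ord0 i) =
    fun z : 'rV[R]_d => \sum_j z ord0 j * A j i.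
  by apply/funext => z; rewrite mxE.
move=> z.
apply: cvg_big; [exact: add_continuous|exact: nbhs_filter|].
move=> j _; exact: (cvgM (@coord_continuous _ _ _ ord0 j z) (cvg_cst _)).
Qed.

(** By compactness of the unit vectors of the tangent cone, positivity of the
    quadratic form of the Jacobian is uniform. *)
Lemma regular_coercive X V xs : regular_solution X V xs ->
  exists2 c : R, 0 < c & forall z, tangent_cone X xs z ->
    c * dotv z z <= dotv (z *m jacobian V xs) z.
Proof.
move=> [_ _ Jpos].
pose q z := dotv (z *m jacobian V xs) z.
have qE z : q z = (z *m jacobian V xs *m z^T) ord0 ord0.
  by rewrite mxE; apply: eq_bigr => i _; rewrite !mxE.
have idc i : continuous (fun z : 'rV[R]_d => z ord0 i) by exact: coord_continuous.
have qc : continuous q by apply: continuous_dotv => //; exact: continuous_mulmx_coord.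
have nc : continuous (fun z : 'rV[R]_d => dotv z z) by exact: continuous_dotv.
pose S := tangent_cone X xs `&` [set z | dotv z z = 1].
have Scpt : compact S.
  apply: bounded_closed_compact.
    exists 1; split; first exact: num_real.
    move=> M M1 z [_ /= z1]; apply: le_trans (ltW M1).
    by apply: (le_trans (mxnorm_le_enorm z)); rewrite /enorm z1 sqrtr1.
  apply: closedI; first exact: closed_closure.
  by apply: (closed_comp (D := [set 1 : R])) => [z _|]; [exact: nc|exact: closed_eq].
have cone z a : 0 <= a -> tangent_cone X xs z -> tangent_cone X xs (a *: z).
  move=> a0 Tz; rewrite /tangent_cone.
  have cs : continuous ( *:%R a : 'rV[R]_d -> 'rV[R]_d) by exact: scaler_continuous.
  move=> B /cs /Tz [y [[c [w [c0 Xw ->]]] By]].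
  exists (a *: (c *: (w - xs))); split => //.
  by exists (a * c), w; split => //; [exact: mulr_ge0|rewrite scalerA].
have [c c0 hc] : exists2 c : R, 0 < c & forall z, S z -> c <= q z.
  have [[z0 Sz0]|S0] := pselect (S !=set0); last first.
    by exists 1 => // z Sz; case: S0; exists z.
  have [c Sc cmin] := EVT_min_rV (ex_intro _ z0 Sz0) Scpt (continuous_subspaceT qc).
  exists (q c).
    rewrite qE; apply: Jpos; first by have /set_mem[] := Sc.
    apply/eqP => c0; have /set_mem[_ /=] := Sc.
    by move/eqP; rewrite c0 dotv0 eq_sym oner_eq0.
  by move=> z Sz; apply: cmin; exact: mem_set.
exists c => // z Tz.
have [->|z0] := eqVneq z 0.
  by rewrite mul0mx dotv0 mulr0.
have n0 : 0 < enorm z by rewrite sqrtr_gt0 lt0r dotv_eq0 z0 dotv_ge0.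
have n0' : enorm z != 0 by rewrite gt_eqF.
have := hc ((enorm z)^-1 *: z); rewrite /q -scalemxAl !dotvE -enorm_sqr => H.
have {H} : c <= (enorm z)^-1 * ((enorm z)^-1 * dotv (z *m jacobian V xs) z).
  apply: H; split; first by apply: cone => //; rewrite invr_ge0 ltW.
  by rewrite /= !dotvE -enorm_sqr; field.
rewrite mulrA -expr2 -(ler_pM2r (exprn_gt0 2 n0)) => /le_trans; apply.
by rewrite mulrAC -exprMn mulVf// expr1n mul1r.
Qed.

Lemma tangent_cone_sub X x xs : X x -> tangent_cone X xs (x - xs).
Proof. by move=> Xx; apply: subset_closure; exists 1, x; rewrite scale1r. Qed.

(** A regular solution has a neighborhood on which the field is bounded,
    continuous, and strongly monotone with respect to the solution. *)
Lemma regular_local X V xs : regular_solution X V xs ->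
  exists r a K : R, [/\ 0 < r, 0 < a &
    forall x, X x -> dotv (x - xs) (x - xs) <= r ^+ 2 ->
    [/\ {for x, continuous V}, enorm (V x) <= K &
      a * dotv (x - xs) (x - xs) <= dotv (V x) (x - xs)]].
Proof.
move=> reg; have [[Xxs sol] C1 _] := reg.
have [c c0 hc] := regular_coercive reg.
have dV : differentiable V xs by have /nbhs_singleton[] := C1.
(* eps bounds the linearization error in the max norm; the dimension enters when
   this norm is compared with the Euclidean one, so that d * eps^2 <= c^2 / 4 *)
pose eps : R := c / (2 * (d%:R + 1)).
have d0 : 0 <= d%:R :> R by exact: ler0n.
have eps0 : 0 < eps by rewrite divr_gt0// mulr_gt0//; lra.
have C1' : \forall y \near xs, {for y, continuous V}.
  by apply: filterS C1 => y [dy _]; exact: differentiable_continuous.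
have Vb : \forall y \near xs, `|V y - V xs| <= 1.
  have /cvgr_dist_le/(_ _ ltr01) := differentiable_continuous dV.
  by apply: filterS => y; rewrite distrC.
have Vd : \forall y \near xs,
    `|V y - V xs - (y - xs) *m jacobian V xs| <= eps * `|y - xs|.
  have /diff_locallyP[_ /eqaddoP/(_ _ eps0)] := dV.
  rewrite [X in X -> _](near_shift xs) sub0r => h.
  near=> y.
  have : (forall v, 'd V xs v = v *m jacobian V xs).
    by move=> v; rewrite /jacobian mul_rV_lin1.
  move=> <-.
  have : `|((V \o shift xs) \- (cst (V xs) \+ 'd V xs)) (y - xs)| <= eps * `|y - xs|.
    by near: y.
  by rewrite /= /shift/= subrK opprD addrA.
have [r r0 hr] : exists2 r : R, 0 < r & forall y, `|y - xs| <= r ->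
    [/\ {for y, continuous V}, `|V y - V xs| <= 1 &
    `|V y - V xs - (y - xs) *m jacobian V xs| <= eps * `|y - xs|].
  have : \forall y \near xs, [/\ {for y, continuous V}, `|V y - V xs| <= 1 &
    `|V y - V xs - (y - xs) *m jacobian V xs| <= eps * `|y - xs|].
    by near=> y; split; near: y.
  move=> /nbhs_ballP[r /= r0 hr]; exists (r / 2); first by rewrite divr_gt0.
  move=> y yr; apply: hr; rewrite -ball_normE/= distrC.
  by apply: (le_lt_trans yr); rewrite ltr_pdivrMr//; lra.
exists r, (c / 2), (Num.sqrt (d%:R * (`|V xs| + 1) ^+ 2)); split => //.
  by rewrite divr_gt0.
move=> x Xx xr.
have {}xr : `|x - xs| <= r.
  apply: (le_trans (mxnorm_le_enorm _)).
  by rewrite -ler_sqr ?nnegrE ?enorm_ge0 ?(ltW r0)// enorm_sqr.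
have [Vc V1 Ve] := hr _ xr; split => //.
  rewrite /enorm ler_sqrt; last by rewrite mulr_ge0// sqr_ge0.
  apply: (le_trans (dotv_le_mxnorm _)); apply: ler_wpM2l => //.
  rewrite lerXn2r ?nnegrE ?addr_ge0//.
  by rewrite -[V x](subrK (V xs)) (le_trans (ler_normD _ _))// addrC lerD2l.
have s0 := sol _ Xx.
have := hc _ (@tangent_cone_sub X x xs Xx).
move: Ve; set e := _ - _ *m _; set u := x - xs => Ve hu.
have VE : V x = e + V xs + u *m jacobian V xs.
  by rewrite /e addrAC subrK subrK.
have h := dotv_ge0 (e - (- (c / 2)) *: u).
have he : dotv e e <= c ^+ 2 / 4 * dotv u u.
  apply: (le_trans (dotv_le_mxnorm _)).
  have : `|e| ^+ 2 <= (eps * `|u|) ^+ 2.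
    by rewrite lerXn2r ?nnegrE// mulr_ge0// ltW.
  move=> /(ler_wpM2l d0) /le_trans; apply.
  have u2 : `|u| ^+ 2 <= dotv u u.
    by rewrite -enorm_sqr lerXn2r ?nnegrE ?enorm_ge0// mxnorm_le_enorm.
  rewrite exprMn mulrA; apply: ler_pM => //.
    by rewrite mulr_ge0// sqr_ge0.
  rewrite /eps expr_div_n mulrA ler_pdivrMr; last by rewrite exprn_gt0//; lra.
  rewrite mulrAC [leRHS](_ : _ = c ^+ 2 * (d%:R + 1) ^+ 2); last by field.
  rewrite mulrC; apply: ler_wpM2l; first exact: sqr_ge0.
  by nra.
rewrite VE (dotvDl (e + V xs)) (dotvDl e); rewrite -/u in s0.
rewrite dotv_subZ in h.
have h2 : - (c * dotv e u) <= c ^+ 2 / 2 * dotv u u by nra.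
have h3 : - dotv e u <= c / 2 * dotv u u.
  rewrite -(ler_pM2l c0) mulrN (le_trans h2)// le_eqVlt; apply/orP; left.
  by apply/eqP; field.
lra.
Unshelve. all: by end_near. Qed.

End Regularity.

(** * Random vectors *)

Section RandomVectors.
Context {R : realType} {d : nat} {disp : measure_display} {T : measurableType disp}.
Implicit Types (Y : T -> 'rV[R]_d) (O : set 'rV[R]_d).

Lemma random_vector_closed_ball Y (q : 'rV[R]_d) (r : R) : 0 <= r ->
  random_vector Y -> measurable [set w | `|Y w - q| <= r].
Proof.
move=> r0 mY.
have -> : [set w | `|Y w - q| <= r] =
    \bigcap_(i in [set: 'I_d]) [set w | `|Y w ord0 i - q ord0 i| <= r].
  apply/seteqP; split => [w /= h i _ /=|w /= h].
    by apply: le_trans h; have := mxnorm_coord_le (Y w - q) i; rewrite !mxE.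
  by apply: mxnorm_le => // i; rewrite !mxE; exact: h.
apply: fin_bigcap_measurable => // i _.
rewrite -[X in measurable X]setTI.
have mf : measurable_fun setT (fun w => `|Y w ord0 i - q ord0 i|).
  apply: measurableT_comp => //.
  by apply: measurable_funB; [exact: mY|exact: measurable_cst].
have := mf measurableT `]-oo, r]%classic (measurable_itv _).
by congr measurable; apply/seteqP; split => w /=; rewrite in_itv.
Qed.

(** Countably many closed balls with rational center exhaust an open set. *)
Lemma random_vector_open Y O : random_vector Y -> open O -> measurable (Y @^-1` O).
Proof.
move=> mY oO.
pose B (qn : 'rV[rat]_d * nat) : set 'rV[R]_d :=
  [set y | `|y - map_mx ratr qn.1| <= qn.2.+1%:R^-1].
pose F qn := if `[< B qn `<=` O >] then Y @^-1` B qn else set0.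
have -> : Y @^-1` O = \bigcup_(qn in [set: 'rV[rat]_d * nat]) F qn.
  apply/seteqP; split => [w /= Ow|w [qn _]]; last first.
    by rewrite /F; case: asboolP => // BO; exact: BO.
  move: oO; rewrite openE => /(_ _ Ow) /nbhs_ballP[e /= e0 eO].
  have [n ne] : exists n : nat, 2 * n.+1%:R^-1 < e.
    have [n _ /(_ _ (leqnn n))] := near_infty_natSinv_lt (PosNum (divr_gt0 e0 (ltr0n R 2))).
    by move=> /= h; exists n; move: h; rewrite ltr_pdivlMr// mulrC.
  have n0 : 0 < n.+1%:R^-1 :> R by rewrite invr_gt0 ltr0n.
  have /choice[q hq] : forall i, exists q : rat, `|Y w ord0 i - ratr q| <= n.+1%:R^-1.
    move=> i; have /rat_in_itvoo[q] :
        Y w ord0 i - n.+1%:R^-1 < Y w ord0 i + n.+1%:R^-1.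
      by rewrite ltrBlDr -addrA ltrDl addr_gt0.
    rewrite in_itv/= => hq; exists q; rewrite ler_distlC.
    by case/andP: hq => /ltW -> /ltW ->.
  have Bw : B (\row_i q i, n) (Y w).
    by apply: mxnorm_le => [|i]; [exact: ltW|rewrite !mxE; exact: hq].
  exists (\row_i q i, n) => //; rewrite /F; case: asboolP => // nBO; exfalso; apply: nBO.
  move=> y By; apply: eO; rewrite -ball_normE /=.
  have -> : Y w - y = (Y w - map_mx ratr (\row_i q i)) - (y - map_mx ratr (\row_i q i)).
    by apply/rowP => i; rewrite !mxE; ring.
  apply: le_lt_trans ne; apply: (le_trans (ler_normB _ _)).
  by rewrite mulrC mulr_natr mulr2n lerD.
apply: countable_bigcupT_measurable; first exact: countableP.
move=> qn; rewrite /F; case: asboolP => // _.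
by apply: random_vector_closed_ball => //; rewrite invr_ge0 ler0n.
Qed.

(** A real function on the sample space that varies continuously with a random
    vector on a measurable event is measurable there. This covers functions that
    are not given as a composition with a continuous map defined everywhere. *)
Lemma measurable_fun_along Y (D : set T) (f : T -> R) :
  measurable D -> random_vector Y ->
  (forall w e, D w -> 0 < e -> exists2 h, 0 < h &
     forall w', D w' -> `|Y w' - Y w| < h -> `|f w' - f w| < e) ->
  measurable_fun D f.
Proof.
move=> mD mY fc; apply: (measurability _ (RGenOInfty.measurableE R)).
move=> _ [_ [x ->] <-].
(* on D, the event x < f is the preimage of the open set O *)
pose O : set 'rV[R]_d := \bigcup_(wh in [set wh : T * R | [/\ D wh.1, 0 < wh.2 &
   forall w', D w' -> `|Y w' - Y wh.1| < wh.2 -> x < f w']]) ball (Y wh.1) wh.2.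
have -> : D `&` f @^-1` `]x, +oo[ = D `&` Y @^-1` O.
  apply/seteqP; split => w [Dw]; rewrite /= ?in_itv/= ?andbT.
    move=> xf; split => //.
    have [h h0 hf] := fc w (f w - x) Dw (eqbRL (subr_gt0 _ _) xf).
    exists (w, h) => /=; last exact: ballxx.
    split => // w' Dw' /hf => /(_ Dw'); rewrite ltr_norml => /andP[]; lra.
  move=> [[w0 h] /= [Dw0 h0 H] Bw]; split => //; rewrite /= ?in_itv/= ?andbT.
  by apply: H => //; move: Bw; rewrite -ball_normE /= distrC.
apply: measurableI => //; apply: random_vector_open => //.
by apply: bigcup_open => -[w h] [/= ? h0 ?]; exact: ball_open.
Qed.

Lemma random_vector_lin Y Z (a : R) : random_vector Y -> random_vector Z ->
  random_vector (fun w => Y w - a *: Z w).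
Proof.
move=> mY mZ i; under eq_fun do rewrite !mxE.
apply: measurable_funB; first exact: mY.
by apply: measurable_funM; [exact: measurable_cst|exact: mZ].
Qed.

(** The projection of a random vector is a random vector, because projections
    are nonexpansive. *)
Lemma random_vector_eproj (X : set 'rV[R]_d) Y (p : T -> 'rV[R]_d) :
  convex_set (X : set (convex_lmodType 'rV[R]_d)) ->
  random_vector Y -> (forall w, is_eproj X (Y w) (p w)) -> random_vector p.
Proof.
move=> Xcv mY hp i; apply: (measurable_fun_along (Y := Y)) => // w e _ e0.
have d0 : 0 <= d%:R :> R by exact: ler0n.
have d1 : 0 < d%:R + 1 :> R by lra.
exists (e / (d%:R + 1)) => [|w' _ hw]; first by rewrite divr_gt0.
rewrite -ltr_sqr ?nnegrE ?(ltW e0)// real_normK ?num_real//.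
have := coord_sqr_le (p w' - p w) i; rewrite !mxE => /le_lt_trans; apply.
apply: (le_lt_trans (eproj_nonexpansive Xcv (hp w') (hp w))).
apply: (le_lt_trans (dotv_le_mxnorm _)).
have : `|Y w' - Y w| ^+ 2 < (e / (d%:R + 1)) ^+ 2.
  have e1 : 0 <= e / (d%:R + 1) by apply: divr_ge0; exact: ltW.
  by rewrite ltr_sqr ?nnegrE.
rewrite expr_div_n ltr_pdivlMr ?exprn_gt0// => h; apply: le_lt_trans h.
rewrite mulrC; apply: ler_wpM2l; first exact: sqr_ge0.
by nra.
Qed.

Lemma measurable_dotv Y Z : random_vector Y -> random_vector Z ->
  measurable_fun setT (fun w => dotv (Y w) (Z w)).
Proof.
by move=> mY mZ; apply: measurable_sum => i; apply: measurable_funM; [exact: mY|exact: mZ].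
Qed.

End RandomVectors.

(** * Real sequences *)

Section RealSequences.
Context {R : realType}.
Implicit Types (a y : nat -> R) (b q Q : R).

(** The product of the factors 1 - e / (t + b) tends to zero: with m e >= 1,
    Bernoulli's inequality shows that its m-th power is O(1 / (t + b)). *)
Lemma contraction_cvg0 y (e b : R) : 0 < e -> 1 <= b ->
  (forall t, 0 <= y t) -> (forall t, e <= t.+1%:R + b) ->
  (forall t, y t.+1 <= (1 - e / (t.+1%:R + b)) * y t) ->
  forall eta, 0 < eta -> \forall t \near \oo, y t <= eta.
Proof.
move=> e0 b1 y0 eb hy eta eta0.
have [m em] : exists m : nat, 1 <= m%:R * e.
  exists (Num.trunc e^-1).+1; rewrite -ler_pdivrMr// div1r ltW//.
  exact: truncnS_gt.
have s0 t : 0 < t%:R + b by rewrite (lt_le_trans ltr01)// (le_trans b1)// lerDr.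
have fac t : (1 - e / (t.+1%:R + b)) ^+ m * (t.+1%:R + b + 1) <= t.+1%:R + b.
  set s := t.+1%:R + b; have sp : 0 < s by exact: s0.
  set x := e / s.
  have x0 : 0 <= x by rewrite divr_ge0// ltW.
  have x1 : x <= 1 by rewrite ler_pdivrMr// mul1r eb.
  have bern : 1 + m%:R * x <= (1 + x) ^+ m.
    elim: (m) => [|k IH]; first by rewrite mul0r addr0 expr0.
    rewrite exprS -natr1; have k0 : 0 <= k%:R :> R by exact: ler0n.
    have := ler_wpM2l (addr_ge0 ler01 x0) IH; nra.
  have mx : s + 1 <= s * (1 + m%:R * x).
    rewrite mulrDr mulr1 lerD2l (_ : s * _ = m%:R * e)// /x.
    by field; rewrite gt_eqF.
  apply: (@le_trans _ _ ((1 - x) ^+ m * (s * (1 + x) ^+ m))).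
    apply: ler_wpM2l; first by rewrite exprn_ge0// subr_ge0.
    by apply: (le_trans mx); rewrite ler_pM2l.
  rewrite mulrCA -exprMn ger_pMr// exprn_ile1//; nra.
have dec t : y t ^+ m * (t%:R + b + 1) <= y 0%N ^+ m * (0%:R + b + 1).
  elim: t => // t; apply: le_trans.
  have -> : t%:R + b + 1 = t.+1%:R + b by rewrite -natr1; ring.
  apply: (le_trans _ (ler_wpM2l (exprn_ge0 m (y0 t)) (fac t))).
  rewrite mulrA -exprMn ler_wpM2r//; first by have := s0 t.+1; lra.
  rewrite lerXn2r ?nnegrE//; last by rewrite mulrC.
  by rewrite mulr_ge0// subr_ge0 ler_pdivrMr// mul1r eb.
set K := y 0%N ^+ m * _ in dec.
have := nbhs_infty_ger (K / eta ^+ m); apply: filterS => t Kt.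
rewrite leNgt; apply/negP => etay.
have h1 : eta ^+ m <= y t ^+ m by rewrite lerXn2r ?nnegrE ?(ltW eta0)// ltW.
have em0 : 0 < eta ^+ m by rewrite exprn_gt0.
have := dec t; rewrite leNgt => /negP; apply.
move: Kt; rewrite ler_pdivrMr// => Kt.
apply: (le_lt_trans Kt); rewrite mulrC.
by have := s0 t; have t0 : 0 <= t%:R :> R by []; nra.
Qed.

(** Chung's lemma, with the exact leading constant. *)
Lemma chung a b q Q : 1 < q -> 0 <= Q -> q <= b ->
  (forall t, (0 < t)%N ->
     a t.+1 <= (1 - q / (t%:R + b)) * a t + Q / (t%:R + b) ^+ 2) ->
  exists2 r : nat -> R, r =o_\oo (fun t : nat => (t%:R)^-1 : R) &
    forall t, (0 < t)%N -> a t <= Q / (q - 1) / t%:R + r t.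
Proof.
move=> q1 Q0 qb ha.
(* C / (s - 1) with s = t + b solves the recursion with an inequality, and the part
   u of the sequence above it, shifted by one, is contracted *)
pose C := Q / (q - 1).
have C0 : 0 <= C by rewrite divr_ge0//; lra.
have Cq : C * (q - 1) = Q by rewrite mulfVK// gt_eqF//; lra.
pose u t := Num.max 0 (a t.+1 - C / (t%:R + b)).
have u0 t : 0 <= u t by rewrite le_max lexx.
(* multiplying by s - 1 leaves contraction factors with q - 1 > 0 in place of q *)
pose y t := (t%:R + b) * u t.
have t0 t : 0 <= t%:R :> R by [].
have y0 t : 0 <= y t by rewrite mulr_ge0//; have := t0 t; lra.
have hu t : u t.+1 <= (1 - q / (t.+1%:R + b)) * u t.
  have := t0 t; have /= := ha t.+1 isT; rewrite -natr1.
  set s := t%:R => hs s0.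
  have sq : 0 <= 1 - q / (s + 1 + b) by rewrite subr_ge0 ler_pdivrMr; lra.
  rewrite {1}/u -natr1 -/s ge_max; apply/andP; split; first by apply: mulr_ge0.
  have : a t.+1 - C / (s + b) <= u t by rewrite le_max lexx orbT.
  move=> /(ler_wpM2l sq) /(le_trans _); apply.
  rewrite mulrBr.
  suff : Q / (s + 1 + b) ^+ 2 + (1 - q / (s + 1 + b)) * (C / (s + b))
    <= C / (s + 1 + b) by lra.
  rewrite -Cq -subr_ge0.
  have -> : C / (s + 1 + b) - (C * (q - 1) / (s + 1 + b) ^+ 2 +
     (1 - q / (s + 1 + b)) * (C / (s + b))) =
     C * (q - 1) / ((s + 1 + b) ^+ 2 * (s + b)).
    by field; apply/andP; split; rewrite gt_eqF//; lra.
  apply: divr_ge0; first by rewrite Cq.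
  by apply: mulr_ge0; [exact: sqr_ge0|lra].
have hy t : y t.+1 <= (1 - (q - 1) / (t.+1%:R + b)) * y t.
  have sb : 0 < t.+1%:R + b by have := t0 t.+1; lra.
  have := hu t; rewrite -(ler_pM2l sb) => /le_trans; apply.
  rewrite /y mulrA [leRHS]mulrA ler_wpM2r// -natr1; set s := t%:R.
  rewrite -subr_ge0.
  have s0 : 0 <= s by [].
  have -> : (1 - (q - 1) / (s + 1 + b)) * (s + b) - (s + 1 + b) * (1 - q / (s + 1 + b))
    = (q - 1) / (s + 1 + b).
    by field; rewrite gt_eqF//; lra.
  by rewrite divr_ge0//; lra.
exists (fun t => y t.-1 / t%:R).
  apply/eqoP => eps eps0.
  have ylim := @contraction_cvg0 y (q - 1) b _ _ y0 _ hy eps eps0.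
  have [N _ hN] : \forall t \near \oo, y t <= eps.
    by apply: ylim; [lra|lra|move=> t; have := t0 t.+1; lra].
  exists N.+1 => // t /= Nt.
  rewrite normrM normfV ger0_norm// ler_wpM2r ?invr_ge0//.
  by apply: hN => /=; case: t Nt.
case=> // t _ /=.
have sb : 0 < t%:R + b by have := t0 t; lra.
have : a t.+1 - C / (t%:R + b) <= u t by rewrite le_max lexx orbT.
have -> : u t = y t / (t%:R + b) by rewrite /y mulrAC mulfV ?mul1r// gt_eqF.
rewrite lerBlDl => /le_trans; apply.
have ti : (t%:R + b)^-1 <= t.+1%:R^-1.
  by rewrite lef_pV2 ?posrE ?ltr0n// -natr1; lra.
by apply: lerD; apply: ler_wpM2l.
Qed.

(** By telescoping, the squares of the steps 1 / (t + b) have sum at most 1 / b. *)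
Lemma sum_sqr_step_le b n : 0 < b ->
  \sum_(0 <= t < n) ((t.+1%:R + b) ^- 2) <= b^-1 :> R.
Proof.
move=> b0; suff : \sum_(0 <= t < n) ((t.+1%:R + b) ^- 2) <= b^-1 - (n%:R + b)^-1 :> R.
  by move/le_trans; apply; rewrite gerBl invr_ge0 addr_ge0// ltW.
elim: n => [|n IH]; first by rewrite big_geq// add0r subrr.
rewrite big_nat_recr//=; apply: (le_trans (lerD IH (lexx _))).
have n0 : 0 <= n%:R :> R by [].
rewrite -natr1; move: (n%:R : R) n0 => x x0.
rewrite -subr_ge0 (_ : _ - _ = ((x + b) * (x + 1 + b) ^+ 2)^-1).
  by rewrite invr_ge0 mulr_ge0 ?sqr_ge0//; lra.
by field; rewrite !gt_eqF//; lra.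
Qed.

End RealSequences.

(** * Expectation and adapted functions *)

Section Expectation.
Context {R : realType} {disp : measure_display} {T : measurableType disp}.
Variable P : probability T R.
Implicit Types (f g z W : T -> R) (A : set T) (a c : R).

(** Real-valued expectation, meaningful for integrable functions. *)
Definition Ex f : R := Rintegral P setT f.

(** Integrability of a real-valued random variable. *)
Definition L1 f := P.-integrable setT (EFin \o f).

Lemma L1_meas f : L1 f -> measurable_fun setT f.
Proof. by move=> /measurable_int /measurable_EFinP. Qed.

Lemma L1_le f g : measurable_fun setT f -> (forall w, `|f w| <= g w) -> L1 g -> L1 f.
Proof.
move=> mf fg; apply: le_integrable => //; first exact/measurable_EFinP.
by move=> w _; rewrite /= lee_fin (le_trans (fg w))// ler_norm.
Qed.

Lemma L1_cst a : L1 (fun=> a).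
Proof. exact: finite_measure_integrable_cst. Qed.

Lemma L1_bounded f c : measurable_fun setT f -> (forall w, `|f w| <= c) -> L1 f.
Proof. by move=> mf fc; apply: (L1_le mf fc); exact: L1_cst. Qed.

Lemma L1D f g : L1 f -> L1 g -> L1 (fun w => f w + g w).
Proof.
move=> hf hg; have := @integrableD _ _ _ P setT measurableT _ _ hf hg.
by apply: eq_integrable.
Qed.

Lemma L1Z a f : L1 f -> L1 (fun w => a * f w).
Proof.
move=> hf; have := @integrableZl _ _ _ P setT measurableT a _ hf.
by apply: eq_integrable.
Qed.

Lemma L1B f g : L1 f -> L1 g -> L1 (fun w => f w - g w).
Proof.
move=> hf hg; have := @integrableB _ _ _ P setT measurableT _ _ hf hg.
by apply: eq_integrable.
Qed.

Lemma L1_sum I (s : seq I) (F : I -> T -> R) :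
  (forall i, L1 (F i)) -> L1 (fun w => \sum_(i <- s) F i w).
Proof.
move=> hF; elim: s => [|i s IH].
  by under eq_fun do rewrite big_nil; exact: L1_cst.
by under eq_fun do rewrite big_cons; exact: L1D.
Qed.

Lemma L1_mul_bounded W z c : measurable_fun setT W -> (forall w, `|W w| <= c) ->
  L1 z -> L1 (fun w => W w * z w).
Proof.
move=> mW Wc Lz.
have Lz' : L1 (fun w => c * `|z w|) by apply: L1Z; exact: integrable_norm.
apply: L1_le Lz'; first by apply: measurable_funM => //; exact: L1_meas.
by move=> w; rewrite normrM ler_wpM2r.
Qed.

Lemma ExD f g : L1 f -> L1 g -> Ex (fun w => f w + g w) = Ex f + Ex g.
Proof. by move=> hf hg; exact: RintegralD. Qed.

Lemma ExB f g : L1 f -> L1 g -> Ex (fun w => f w - g w) = Ex f - Ex g.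
Proof. by move=> hf hg; exact: RintegralB. Qed.

Lemma ExZ a f : L1 f -> Ex (fun w => a * f w) = a * Ex f.
Proof. by move=> hf; exact: RintegralZl. Qed.

Lemma Ex_cst a : Ex (fun=> a) = a.
Proof.
have P1 : fine (P setT) = 1 by rewrite probability_setT.
by rewrite /Ex Rintegral_cst//; apply: (etrans _ (mulr1 a)); congr (_ * _); exact: P1.
Qed.

Lemma Ex_sum I (s : seq I) (F : I -> T -> R) : (forall i, L1 (F i)) ->
  Ex (fun w => \sum_(i <- s) F i w) = \sum_(i <- s) Ex (F i).
Proof.
move=> hF; elim: s => [|i s IH].
  by under eq_fun do rewrite big_nil; rewrite Ex_cst big_nil.
under eq_fun do rewrite big_cons; rewrite ExD//; last exact: L1_sum.
by rewrite IH big_cons.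
Qed.

Lemma le_Ex f g : L1 f -> L1 g -> (forall w, f w <= g w) -> Ex f <= Ex g.
Proof. by move=> hf hg fg; apply: le_Rintegral. Qed.

Lemma Ex_ge0 f : (forall w, 0 <= f w) -> 0 <= Ex f.
Proof. by move=> f0; apply: Rintegral_ge0. Qed.

Lemma L1_indic A : measurable A -> L1 (\1_A : T -> R).
Proof. by move=> mA; exact: integrable_indic. Qed.

Lemma Ex_indic A : measurable A -> Ex (\1_A : T -> R) = fine (P A).
Proof. by move=> mA; rewrite /Ex /Rintegral integral_indic// setIT. Qed.

Lemma indic_le1 A w : `|\1_A w : R| <= 1.
Proof. by rewrite indicE; case: (_ \in _); rewrite ?normr1 ?normr0. Qed.

Lemma indic_ge0 A w : 0 <= \1_A w :> R.
Proof. by rewrite indicE. Qed.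

Lemma L1_mul_indic A f : measurable A -> L1 f -> L1 (fun w => \1_A w * f w).
Proof.
by move=> mA; apply: L1_mul_bounded => [|w]; [exact: measurable_indic|exact: indic_le1].
Qed.

Lemma Ex_restrict A f : measurable A ->
  Ex (fun w => \1_A w * f w) = fine (\int[P]_(w in A) (f w)%:E)%E.
Proof.
move=> mA; rewrite -[RHS]/(Rintegral P A f) Rintegral_mkcond.
congr (Rintegral _ _ _); apply/funext => w; rewrite patchE indicE.
by case: (_ \in _); rewrite ?mul1r ?mul0r.
Qed.

(** Measurability with respect to the sigma-algebra generated by [C]. *)
Definition adapted (C : set (set T)) f :=
  measurable_fun setT (f : g_sigma_algebraType C -> R).

Lemma generated_measurable (C : set (set T)) A : C `<=` measurable -> <<s C >> A ->
  measurable A.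
Proof.
by move=> Cm; apply: smallest_sub => //; exact: sigma_algebra_measurable.
Qed.

Lemma adapted_measurable C f : C `<=` measurable -> adapted C f -> measurable_fun setT f.
Proof.
move=> Cm hf _ B mB.
by apply: (generated_measurable Cm); exact: (hf measurableT B mB).
Qed.

Lemma adapted_indic C A : <<s C >> A -> adapted C (\1_A).
Proof. by move=> CA; exact: (@measurable_indic _ (g_sigma_algebraType C)). Qed.

(** A random variable that integrates to zero over every event of a
    sub-sigma-algebra is orthogonal to the bounded functions adapted to it. *)
Lemma Ex_adapted_mul C W z c : C `<=` measurable -> L1 z ->
  (forall A, <<s C >> A -> Ex (fun w => \1_A w * z w) = 0) ->
  adapted C W -> (forall w, `|W w| <= c) -> Ex (fun w => W w * z w) = 0.
Proof.
move=> Cm Lz z0 mW Wc.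
have Lnz : L1 (fun w => `|z w|) by exact: integrable_norm.
(* recentring W by c / 2 according to its sign halves its bound and leaves the
   integral unchanged *)
have key n W' c' : adapted C W' -> (forall w, `|W' w| <= c') ->
    `|Ex (fun w => W' w * z w)| <= c' / 2 ^+ n * Ex (fun w => `|z w|).
  elim: n W' c' => [|n IH] W' c' mW' Wc'.
    have mW0 := adapted_measurable Cm mW'.
    have LWz := L1_mul_bounded mW0 Wc' Lz.
    rewrite expr0 divr1 -ExZ//; apply: (le_trans (le_normr_Rintegral _ _)) => //.
    apply: le_Ex; [exact: integrable_norm|exact: L1Z|].
    by move=> w; rewrite normrM ler_wpM2r.
  pose B := W' @^-1` `[0, +oo[.
  have CB : <<s C >> B.
    by have := mW' measurableT `[0, +oo[%classic (measurable_itv _); rewrite setTI.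
  pose W1 w := W' w - c' * \1_B w + c' / 2.
  have mW1 : adapted C W1.
    apply: measurable_funD; last exact: measurable_cst.
    apply: measurable_funB => //; apply: measurable_funM; first exact: measurable_cst.
    exact: adapted_indic.
  have W1c w : `|W1 w| <= c' / 2.
    have := Wc' w; rewrite /W1 !ler_norml => /andP[h1 h2].
    have [h|h] := leP 0 (W' w).
      rewrite indicE mem_set /B /= ?in_itv/= ?h//.
      by apply/andP; split; lra.
    rewrite indicE memNset /B /= ?in_itv/= ?andbT; last by apply/negP; rewrite -ltNge.
    by apply/andP; split; lra.
  have := IH _ _ mW1 W1c.
  have -> : Ex (fun w => W1 w * z w) = Ex (fun w => W' w * z w).
    have -> : (fun w => W1 w * z w) =
       (fun w => W' w * z w - c' * (\1_B w * z w) + c' / 2 * (\1_setT w * z w)).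
      apply/funext => w; have -> : \1_setT w = 1 :> R by rewrite indicE in_setT.
      by rewrite /W1; ring.
    have mB := generated_measurable Cm CB.
    have L1' := L1_mul_bounded (adapted_measurable Cm mW') Wc' Lz.
    have LB := L1_mul_indic mB Lz.
    have LT := L1_mul_indic measurableT Lz.
    have CT : <<s C >> setT by exact: (@measurableT _ (g_sigma_algebraType C)).
    rewrite ExD; [|by apply: L1B => //; exact: L1Z|exact: L1Z].
    rewrite ExB//; last exact: L1Z.
    by rewrite !ExZ// !z0// !mulr0 subr0 addr0.
  by rewrite exprS invfM mulrA.
apply/eqP; rewrite -normr_le0; apply/ler_addgt0Pl => e e0; rewrite addr0.
set E := Ex (fun w => `|z w|).
have E0 : 0 <= E by exact: Ex_ge0.
have [n hn] : exists n, `|c| * E / e <= 2 ^+ n.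
  exists (Num.trunc (`|c| * E / e)).+1; apply: (le_trans (ltW (truncnS_gt _))).
  rewrite -natrX ler_nat; exact/ltnW/ltn_expl.
apply: (le_trans (key n _ `|c| mW _)) => [w|]; first exact: (le_trans (Wc w) (ler_norm _)).
rewrite mulrAC ler_pdivrMr ?exprn_gt0//.
by move: hn; rewrite ler_pdivrMr// (mulrC _ e).
Qed.

End Expectation.

(** * Conditionally centred noise *)

Section Noise.
Context {R : realType} {d : nat} {disp : measure_display} {T : measurableType disp}.
Variable P : probability T R.
Implicit Types (W Z : T -> 'rV[R]_d) (C : set (set T)).

Lemma is_cond_exp0_L1 C (z : T -> R) :
  is_cond_exp P <<s C >> z (cst 0) -> L1 P z.
Proof. by case. Qed.

Lemma is_cond_exp0_Ex C (z : T -> R) : C `<=` measurable ->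
  is_cond_exp P <<s C >> z (cst 0) ->
  forall A, <<s C >> A -> Ex P (fun w => \1_A w * z w) = 0.
Proof.
move=> Cm [Lz _ _ h] A CA; rewrite Ex_restrict; last exact: generated_measurable CA.
by rewrite h// integral0.
Qed.

(** The noise is orthogonal to every bounded adapted random vector. *)
Lemma Ex_dotv_noise C W Z c : C `<=` measurable ->
  (forall i, is_cond_exp P <<s C >> (fun w => Z w ord0 i) (cst 0)) ->
  (forall i, adapted C (fun w => W w ord0 i)) ->
  (forall w i, `|W w ord0 i| <= c) ->
  L1 P (fun w => dotv (W w) (Z w)) /\ Ex P (fun w => dotv (W w) (Z w)) = 0.
Proof.
move=> Cm hZ hW Wc.
have L i : L1 P (fun w => W w ord0 i * Z w ord0 i).
  apply: (L1_mul_bounded (c := c)) => //; last exact: is_cond_exp0_L1 (hZ i).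
  exact: adapted_measurable (hW i).
split; first exact: L1_sum.
rewrite Ex_sum// big1// => i _.
apply: (Ex_adapted_mul (C := C) (c := c)) => //; first exact: is_cond_exp0_L1 (hZ i).
exact: is_cond_exp0_Ex.
Qed.

Lemma Ex_noise_sqr C Z (sigma : R) :
  (exists2 Y, is_cond_exp P <<s C >> (fun w => enorm (Z w) ^+ 2) Y &
     {ae P, forall w, Y w <= sigma ^+ 2}) ->
  L1 P (fun w => dotv (Z w) (Z w)) /\ Ex P (fun w => dotv (Z w) (Z w)) <= sigma ^+ 2.
Proof.
move=> [Y [LZ LY _ hZ] Ys].
have -> : (fun w => dotv (Z w) (Z w)) = (fun w => enorm (Z w) ^+ 2).
  by apply/funext => w; rewrite enorm_sqr.
split => //.
have CT : <<s C >> setT by exact: (@measurableT _ (g_sigma_algebraType C)).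
have -> : Ex P (fun w => enorm (Z w) ^+ 2) = Ex P Y by rewrite /Ex /Rintegral hZ.
(* Y is at most sigma^2 only almost everywhere; Y' is so everywhere *)
pose Y' w := Num.min (Y w) (sigma ^+ 2).
have mY : measurable_fun setT Y by exact: L1_meas LY.
have mY' : measurable_fun setT Y' by apply: measurable_minr => //; exact: measurable_cst.
have LY' : L1 P Y'.
  apply: (L1_le (g := fun w => `|Y w| + sigma ^+ 2)) => //.
    move=> w; rewrite /Y'; have s0 := sqr_ge0 sigma.
    by rewrite /Num.min; case: ifP => _; rewrite ?lerDl// ger0_norm// lerDr.
  by apply: L1D; [exact: integrable_norm|exact: L1_cst].
have -> : Ex P Y = Ex P Y'.
  congr fine; apply: ae_eq_integral => //; [exact/measurable_EFinP|exact/measurable_EFinP|].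
  by apply: filterS Ys => w Yw _; rewrite /Y' min_l.
rewrite -[leRHS](Ex_cst P); apply: le_Ex => //; first exact: L1_cst.
by move=> w; rewrite /Y' ge_min lexx orbT.
Qed.

End Noise.

(** * The stochastic past extra-gradient process *)

Section Process.
Context {R : realType} {d : nat} (X : set 'rV[R]_d) (V : 'rV[R]_d -> 'rV[R]_d)
  (xs : 'rV[R]_d) (r a M : R).

(** The trace on [X] of the closed Euclidean ball of center [xs] and radius
    [r]. *)
Definition near_ball : set 'rV[R]_d := [set x | X x /\ dotv (x - xs) (x - xs) <= r ^+ 2].

Context (Xcv : convex_set (X : set (convex_lmodType 'rV[R]_d))) (Xxs : X xs)
  (r0 : 0 < r) (a0 : 0 < a) (M0 : 0 <= M).
Context (Vcont : forall x, near_ball x -> {for x, continuous V})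
  (Vbound : forall x, near_ball x -> dotv (V x) (V x) <= M ^+ 2)
  (Vcoer : forall x, near_ball x -> a * dotv (x - xs) (x - xs) <= dotv (V x) (x - xs)).
Context {disp : measure_display} {T : measurableType disp} (P : probability T R)
  (Xh Xs G Z : nat -> T -> 'rV[R]_d) (sigma : R) (step : nat -> R).
Context (oracle : stochastic_oracle P V sigma Xh Xs G Z)
  (peg : forall w, PEG X step (Xh ^~ w) (Xs ^~ w) (G ^~ w))
  (init : forall w, near_ball (Xh 0%N w)).

(** A generating family of the sigma-algebra [history Xh Xs G t]. *)
Definition hist_gen t : set (set T) :=
  coord_events (Xh 0%N) `|` coord_events (Xs 1%N) `|`
  \bigcup_(k in `I_t) coord_events (G k).

(** Random vectors measurable with respect to the history up to [t]. *)
Definition hist_vector t (Y : T -> 'rV[R]_d) :=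
  forall i, adapted (hist_gen t) (fun w => Y w ord0 i).

Lemma hist_genS t u : (t <= u)%N -> hist_gen t `<=` hist_gen u.
Proof.
move=> tu A [h|[k /= kt h]]; [by left|right; exists k => //=].
exact: leq_trans tu.
Qed.

Lemma coord_events_measurable (Y : T -> 'rV[R]_d) :
  random_vector Y -> coord_events Y `<=` measurable.
Proof. by move=> mY _ [i _ [B mB <-]]; exact: mY. Qed.

Lemma hist_gen_measurable t : hist_gen t `<=` measurable.
Proof.
have [m0 m1 mG] := oracle.
move=> A [[|]|[k _]]; apply: coord_events_measurable => //.
by have [] := mG k.
Qed.

Lemma coord_events_hist_vector (C : set (set T)) (Y : T -> 'rV[R]_d) :
  coord_events Y `<=` C -> forall i, adapted C (fun w => Y w ord0 i).
Proof.
move=> YC i _ B mB; apply: sub_sigma_algebra; apply: YC.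
by exists i => //; exists B.
Qed.

Lemma history_mono t u A : (t <= u)%N -> <<s hist_gen t >> A -> <<s hist_gen u >> A.
Proof. by move=> tu; apply: sub_sigma_algebra2; exact: hist_genS. Qed.

Lemma adaptedS t u (f : T -> R) : (t <= u)%N ->
  adapted (hist_gen t) f -> adapted (hist_gen u) f.
Proof.
move=> tu hf _ B mB; have := hf measurableT B mB.
exact: history_mono.
Qed.

Lemma hist_vectorS t u Y : (t <= u)%N -> hist_vector t Y -> hist_vector u Y.
Proof. by move=> tu hY i; apply: adaptedS tu _; exact: hY. Qed.

Lemma hist_vector_G t k : (k < t)%N -> hist_vector t (G k).
Proof.
by move=> kt i; apply: coord_events_hist_vector => A hA; right; exists k.
Qed.

Lemma hist_vector_Xs t : hist_vector t.+1 (Xs t.+1).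
Proof.
elim: t => [|t IH].
  by apply: coord_events_hist_vector => A hA; left; right.
apply: (@random_vector_eproj _ _ _ (g_sigma_algebraType (hist_gen t.+2)) X
  (fun w => Xs t.+1 w - step t.+1 *: G t.+1 w) _ Xcv).
  apply: (@random_vector_lin _ _ _ (g_sigma_algebraType (hist_gen t.+2))).
    exact: hist_vectorS IH.
  exact: hist_vector_G.
by move=> w; have [_ _ /(_ t.+1 isT)[]] := peg w.
Qed.

Lemma hist_vector_Xh t : hist_vector t (Xh t).
Proof.
case: t => [|t].
  by apply: coord_events_hist_vector => A hA; left; left.
apply: (@random_vector_eproj _ _ _ (g_sigma_algebraType (hist_gen t.+1)) X
  (fun w => Xs t.+1 w - step t.+1 *: G t w) _ Xcv).
  apply: (@random_vector_lin _ _ _ (g_sigma_algebraType (hist_gen t.+1))).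
    exact: hist_vector_Xs.
  exact: hist_vector_G.
by move=> w; have [_ _ /(_ t.+1 isT)[]] := peg w.
Qed.

Lemma hist_vector_dist t Y : hist_vector t Y -> hist_vector t (fun w => Y w - xs).
Proof.
move=> hY i; rewrite /adapted; under eq_fun do rewrite !mxE.
by apply: measurable_funB; [exact: hY|exact: measurable_cst].
Qed.

Lemma adapted_dotv t Y1 Y2 : hist_vector t Y1 -> hist_vector t Y2 ->
  adapted (hist_gen t) (fun w => dotv (Y1 w) (Y2 w)).
Proof.
by move=> h1 h2; exact: (@measurable_dotv _ _ _ (g_sigma_algebraType (hist_gen t))).
Qed.

Lemma Xh_in t w : X (Xh t w).
Proof.
case: t => [|t]; first by have [] := init w.
by have [_ _ /(_ t.+1 isT)[[]]] := peg w.
Qed.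

Lemma Xs_in t w : X (Xs t.+1 w).
Proof.
case: t => [|t]; first by have [] := peg w.
by have [_ _ /(_ t.+1 isT)[_ []]] := peg w.
Qed.

(** The event that no half-step up to time [t] leaves the neighborhood. The
    half-step of index 0 is included, as it is there by assumption. *)
Definition stay t : set T := [set w | forall s, (s <= t)%N -> near_ball (Xh s w)].

Lemma staySub t u : (t <= u)%N -> stay u `<=` stay t.
Proof. by move=> tu w h s st; apply: h; exact: leq_trans tu. Qed.

Lemma stay0 : stay 0%N = setT.
Proof. by apply/seteqP; split => // w _ s; rewrite leqn0 => /eqP ->. Qed.

Lemma staySP t w : stay t w -> near_ball (Xh t.+1 w) -> stay t.+1 w.
Proof.
by move=> h h1 s; rewrite leq_eqVlt => /predU1P[->//|]; rewrite ltnS; exact: h.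
Qed.

Lemma stay_hist t : <<s hist_gen t >> (stay t).
Proof.
have -> : stay t =
    \bigcap_(s in `I_t.+1) [set w | dotv (Xh s w - xs) (Xh s w - xs) <= r ^+ 2].
  apply/seteqP; split => w h s st; first by have [] := h s st.
  by split; [exact: Xh_in|exact: h].
apply: (@fin_bigcap_measurable _ (g_sigma_algebraType (hist_gen t))) => // s /= st.
have mf : adapted (hist_gen s) (fun w => dotv (Xh s w - xs) (Xh s w - xs)).
  by apply: adapted_dotv; apply: hist_vector_dist; exact: hist_vector_Xh.
have := adaptedS (st : (s <= t)%N) mf measurableT (measurable_itv `]-oo, r ^+ 2]).
by congr measurable; apply/seteqP; split => w /=; rewrite in_itv//= => -[].
Qed.

Lemma measurable_stay t : measurable (stay t).
Proof. exact (generated_measurable (@hist_gen_measurable t) (@stay_hist t)). Qed.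

(** Indicator of [stay t]. *)
Definition ind t w : R := \1_(stay t) w.

Lemma ind1 t w : stay t w -> ind t w = 1.
Proof. by move=> h; rewrite /ind indicE mem_set. Qed.

Lemma ind0 t w : ~ stay t w -> ind t w = 0.
Proof. by move=> h; rewrite /ind indicE memNset. Qed.

Lemma ind_adapted t : adapted (hist_gen t) (ind t).
Proof. by apply: adapted_indic; exact: stay_hist. Qed.

(** The field need not be measurable, but it is continuous at every point of the
    neighborhood. *)
Lemma ind_V_adapted t : hist_vector t (fun w => ind t w *: V (Xh t w)).
Proof.
move=> i; rewrite /adapted.
have mS : @measurable _ (g_sigma_algebraType (hist_gen t)) (stay t) by exact: stay_hist.
have -> : (fun w => (ind t w *: V (Xh t w)) ord0 i) =
    (fun w => V (Xh t w) ord0 i) \_ (stay t).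
  apply/funext => w; rewrite mxE patchE /ind indicE.
  by case: (_ \in _); rewrite ?mul1r ?mul0r.
apply: (iffLR (measurable_restrictT _ mS)).
apply: (@measurable_fun_along _ _ _ (g_sigma_algebraType (hist_gen t)) (Xh t)) => //.
  exact: hist_vector_Xh.
move=> w e Sw e0.
have /cvgr_dist_lt/(_ _ e0)/nbhs_ballP[h /= h0 hV] := Vcont (Sw t (leqnn t)).
exists h => // w' Sw' hw.
have := hV (Xh t w'); rewrite -ball_normE /= distrC => /(_ hw); apply: le_lt_trans.
rewrite distrC.
by have := mxnorm_coord_le (V (Xh t w) - V (Xh t w')) i; rewrite !mxE.
Qed.

Lemma near_ball_coord x i : near_ball x -> `|(x - xs) ord0 i| <= r.
Proof.
move=> [_ h]; rewrite -ler_sqr ?nnegrE ?(ltW r0)// real_normK ?num_real//.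
by apply: le_trans h; exact: coord_sqr_le.
Qed.

Lemma V_coord x i : near_ball x -> `|V x ord0 i| <= M.
Proof.
move=> /Vbound h; rewrite -ler_sqr ?nnegrE// real_normK ?num_real//.
by apply: le_trans h; exact: coord_sqr_le.
Qed.

Lemma noise_mean t i : is_cond_exp P <<s hist_gen t >> (fun w => Z t w ord0 i) (cst 0).
Proof. by have [_ _ /(_ t)[_ _ _ + _]] := oracle; apply. Qed.

Lemma noise_sqr t : L1 P (fun w => dotv (Z t w) (Z t w)) /\
  Ex P (fun w => dotv (Z t w) (Z t w)) <= sigma ^+ 2.
Proof.
by have [_ _ /(_ t)[_ _ _ _ h]] := oracle; apply: Ex_noise_sqr h.
Qed.

Lemma G_eq t w : G t w = V (Xh t w) + Z t w.
Proof. by have [_ _ /(_ t)[_ _ + _ _]] := oracle; apply. Qed.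

(** Stopped martingale increments, and stopped squared oracle outputs. *)
Definition mart t w : R := ind t w * dotv (Z t w) (Xh t w - xs).
Definition gsq t w : R := ind t w * dotv (G t w) (G t w).

Lemma ind_ge0 t w : 0 <= ind t w. Proof. exact: indic_ge0. Qed.

Lemma ind_cases t w : (stay t w /\ ind t w = 1) \/ (~ stay t w /\ ind t w = 0).
Proof. by have [h|h] := pselect (stay t w); [left; rewrite ind1|right; rewrite ind0]. Qed.

Lemma gsq_ge0 t w : 0 <= gsq t w.
Proof. by rewrite mulr_ge0 ?ind_ge0 ?dotv_ge0. Qed.

(** The indicator matters: where the field is arbitrary, the noise cannot be
    recovered measurably from the oracle output. *)
Lemma mart_adapted t : adapted (hist_gen t.+1) (mart t).
Proof.
have -> : mart t = (fun w => ind t w * dotv (G t w) (Xh t w - xs)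
    - dotv (ind t w *: V (Xh t w)) (Xh t w - xs)).
  by apply/funext => w; rewrite /mart G_eq dotvZl dotvDl; ring.
have hX : hist_vector t.+1 (fun w => Xh t w - xs).
  by apply: hist_vector_dist; exact: (hist_vectorS (leqnSn t) (@hist_vector_Xh t)).
apply: measurable_funB.
  apply: measurable_funM; first exact: (adaptedS (leqnSn t) (@ind_adapted t)).
  by apply: adapted_dotv => //; exact: hist_vector_G.
by apply: adapted_dotv => //; exact: (hist_vectorS (leqnSn t) (@ind_V_adapted t)).
Qed.

Lemma gsq_adapted t : adapted (hist_gen t.+1) (gsq t).
Proof.
apply: measurable_funM; first exact: (adaptedS (leqnSn t) (@ind_adapted t)).
by apply: adapted_dotv; exact: hist_vector_G.
Qed.

Lemma Ex_mul_mart t W c : adapted (hist_gen t) W -> (forall w, `|W w| <= c) ->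
  L1 P (fun w => W w * mart t w) /\ Ex P (fun w => W w * mart t w) = 0.
Proof.
move=> mW Wc.
pose Y w := (W w * ind t w) *: (Xh t w - xs).
have -> : (fun w => W w * mart t w) = (fun w => dotv (Y w) (Z t w)).
  by apply/funext => w; rewrite /Y dotvZl /mart (dotvC (Z t w)); ring.
apply: (@Ex_dotv_noise _ _ _ _ P (hist_gen t) Y (Z t) (c * r)).
- exact: hist_gen_measurable.
- exact: noise_mean.
- move=> i; rewrite /adapted /Y; under eq_fun do rewrite mxE.
  apply: measurable_funM; last by apply: hist_vector_dist; exact: hist_vector_Xh.
  by apply: measurable_funM => //; exact: ind_adapted.
- move=> w i; rewrite /Y mxE !normrM; have c0 : 0 <= c by exact: le_trans (Wc w).
  have [[Sw ->]|[_ ->]] := ind_cases t w; last by rewrite normr0 mulr0 mul0r mulr_ge0// ltW.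
  by rewrite normr1 mulr1 ler_pM// near_ball_coord//; exact: Sw.
Qed.

Lemma mart_sqr_le t w : mart t w ^+ 2 <= r ^+ 2 * dotv (Z t w) (Z t w).
Proof.
rewrite /mart; have z0 := dotv_ge0 (Z t w).
have [[Sw ->]|[_ ->]] := ind_cases t w; last by rewrite mul0r expr0n mulr_ge0// sqr_ge0.
rewrite mul1r; apply: (le_trans (sqr_dotv_le _ _)); rewrite mulrC ler_wpM2r//.
by have [_] := Sw t (leqnn t).
Qed.

Lemma mart_measurable t : measurable_fun setT (mart t).
Proof. exact: (adapted_measurable (@hist_gen_measurable t.+1) (@mart_adapted t)). Qed.

Lemma gsq_measurable t : measurable_fun setT (gsq t).
Proof. exact: (adapted_measurable (@hist_gen_measurable t.+1) (@gsq_adapted t)). Qed.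

Lemma mart_sqr t : L1 P (fun w => mart t w ^+ 2) /\
  Ex P (fun w => mart t w ^+ 2) <= r ^+ 2 * sigma ^+ 2.
Proof.
have [LZ EZ] := noise_sqr t.
have LZ' : L1 P (fun w => r ^+ 2 * dotv (Z t w) (Z t w)) by exact: L1Z.
have L : L1 P (fun w => mart t w ^+ 2).
  apply: L1_le LZ'; first by apply: measurable_funX; exact: mart_measurable.
  by move=> w; rewrite ger0_norm ?sqr_ge0// mart_sqr_le.
split => //.
apply: (le_trans (le_Ex L LZ' (mart_sqr_le t))).
by rewrite ExZ// ler_wpM2l// sqr_ge0.
Qed.

Lemma mart_mean t : L1 P (mart t) /\ Ex P (mart t) = 0.
Proof.
have c1 (w : T) : `|(1 : R)| <= 1 by rewrite normr1.
have [] := @Ex_mul_mart t (fun=> 1) 1 (measurable_cst _) c1.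
by under eq_fun do rewrite mul1r.
Qed.

(** Second moment of the oracle: the field and the noise are orthogonal, so that
    their second moments add up. *)
Lemma Ex_gsq t : L1 P (gsq t) /\ Ex P (gsq t) <= M ^+ 2 + sigma ^+ 2.
Proof.
have [LZ EZ] := noise_sqr t.
pose Y w := ind t w *: V (Xh t w).
have [LY EY] : L1 P (fun w => dotv (Y w) (Z t w)) /\ Ex P (fun w => dotv (Y w) (Z t w)) = 0.
  apply: (@Ex_dotv_noise _ _ _ _ P (hist_gen t) Y (Z t) M).
  - exact: hist_gen_measurable.
  - exact: noise_mean.
  - exact: ind_V_adapted.
  - move=> w i; rewrite /Y mxE normrM.
    have [[Sw ->]|[_ ->]] := ind_cases t w; last by rewrite normr0 mul0r.
    by rewrite normr1 mul1r V_coord//; exact: Sw.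
pose F w := M ^+ 2 + (2 * dotv (Y w) (Z t w) + dotv (Z t w) (Z t w)).
have L2 : L1 P (fun w => 2 * dotv (Y w) (Z t w)) by exact: L1Z.
have LYZ : L1 P (fun w => 2 * dotv (Y w) (Z t w) + dotv (Z t w) (Z t w)) by exact: L1D.
have LF : L1 P F by apply: L1D => //; exact: L1_cst.
have gF w : gsq t w <= F w.
  rewrite /F /gsq /Y dotvZl; have z0 := dotv_ge0 (Z t w).
  have [[Sw ->]|[_ ->]] := ind_cases t w.
    rewrite G_eq !dotvDl !dotvDr (dotvC (Z t w) (V _)).
    by have := Vbound (Sw t (leqnn t)); lra.
  by have := sqr_ge0 M; lra.
have Lg : L1 P (gsq t).
  apply: L1_le LF; first exact: gsq_measurable.
  by move=> w; rewrite ger0_norm ?gsq_ge0.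
split => //; apply: (le_trans (le_Ex Lg LF gF)).
rewrite ExD//; last exact: L1_cst.
by rewrite ExD// ExZ// Ex_cst EY mulr0 add0r lerD2l.
Qed.

(** Squared distance of the iterate to the solution. *)
Definition sqd t w : R := dotv (Xs t w - xs) (Xs t w - xs).

Lemma sqd_ge0 t w : 0 <= sqd t w. Proof. exact: dotv_ge0. Qed.

(** One step of the algorithm on the event that the iterates are still in the
    neighborhood. *)
Lemma sqd_step t w : stay t.+1 w -> 0 <= step t.+1 -> 2 * a * step t.+1 <= 1 ->
  sqd t.+2 w <= (1 - a * step t.+1) * sqd t.+1 w - 2 * step t.+1 * mart t.+1 w
    + 2 * step t.+1 ^+ 2 * (gsq t.+1 w + gsq t w).
Proof.
move=> Sw s0 s1.
have [_ _ /(_ t.+1 isT)[hh hx]] := peg w.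
have Uh := Sw t.+1 (leqnn _).
have := peg_descent Xcv Xxs hh hx; rewrite /= -/(sqd t.+2 w) -/(sqd t.+1 w).
have hG := sqr_dotvB_le (G t.+1 w) (G t w).
have hV := Vcoer Uh.
have := sqr_dotvD_le (Xh t.+1 w - xs) (Xs t.+1 w - Xh t.+1 w).
have -> : Xh t.+1 w - xs + (Xs t.+1 w - Xh t.+1 w) = Xs t.+1 w - xs.
  by rewrite addrC addrA subrK.
have -> : dotv (Xs t.+1 w - Xh t.+1 w) (Xs t.+1 w - Xh t.+1 w) =
  dotv (Xh t.+1 w - Xs t.+1 w) (Xh t.+1 w - Xs t.+1 w).
  by rewrite -opprB dotvNl dotvNr opprK.
rewrite -/(sqd t.+1 w) /gsq /mart (ind1 Sw) (ind1 (staySub (leqnSn _) Sw)) !mul1r.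
have -> : dotv (G t.+1 w) (Xh t.+1 w - xs) = dotv (V (Xh t.+1 w)) (Xh t.+1 w - xs)
    + dotv (Z t.+1 w) (Xh t.+1 w - xs) by rewrite G_eq dotvDl.
have N0 := dotv_ge0 (Xh t.+1 w - Xs t.+1 w).
move=> h1 h2.
set g := step t.+1 in s0 s1 h2 *.
(* monotonicity, the comparison of both iterates, the triangle inequality for the
   oracle outputs, and absorption of the movement by the smallness of the step *)
have k1 := mulr_ge0 s0 (eqbRL (subr_ge0 _ _) hV).
have k2 := mulr_ge0 (mulr_ge0 (ltW a0) s0) (eqbRL (subr_ge0 _ _) h1).
have k3 := mulr_ge0 (sqr_ge0 g) (eqbRL (subr_ge0 _ _) hG).
have k4 := mulr_ge0 N0 (eqbRL (subr_ge0 _ _) s1).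
lra.
Qed.

(** A half-step moves away from the iterate by at most the step-size times the
    norm of the previous oracle output. *)
Lemma half_step_le t w : stay t w ->
  dotv (Xh t.+1 w - xs) (Xh t.+1 w - xs) <=
  2 * sqd t.+1 w + 2 * step t.+1 ^+ 2 * gsq t w.
Proof.
move=> Sw; have [_ _ /(_ t.+1 isT)[hh _]] := peg w.
have hX : is_eproj X (Xs t.+1 w) (Xs t.+1 w).
  split; first exact: Xs_in.
  by move=> x _; rewrite le_enorm subrr dotv0 dotv_ge0.
have := eproj_nonexpansive Xcv hh hX.
rewrite addrAC subrr add0r dotvNl dotvNr opprK dotvZl dotvZr mulrA -expr2 /= => h.
have := sqr_dotvD_le (Xs t.+1 w - xs) (Xh t.+1 w - Xs t.+1 w).
have -> : Xs t.+1 w - xs + (Xh t.+1 w - Xs t.+1 w) = Xh t.+1 w - xs.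
  by rewrite addrC addrA subrK.
by rewrite /gsq (ind1 Sw) mul1r /sqd; lra.
Qed.

Lemma sqd_adapted t : adapted (hist_gen t.+1) (sqd t.+1).
Proof. by apply: adapted_dotv; apply: hist_vector_dist; exact: hist_vector_Xs. Qed.

Lemma sqd_measurable t : measurable_fun setT (sqd t.+1).
Proof. exact: (adapted_measurable (@hist_gen_measurable t.+1) (@sqd_adapted t)). Qed.

(** * Staying in the neighborhood *)

(** The first iterate is assumed to be well inside the ball of radius [r]. *)
Section Stability.
Context (step_ge0 : forall k, 0 <= step k.+1)
  (step_dec : forall k, step k.+2 <= step k.+1)
  (step_small : forall k, 2 * a * step k.+1 <= 1)
  (init1 : forall w, sqd 1 w <= r ^+ 2 / 8).

(* share of r^2 allotted to each of the initial distance, the martingale part and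
   the squared steps; twice their total is 6 c < r^2 *)
Let c : R := r ^+ 2 / 8.

Lemma c_gt0 : 0 < c. Proof. by rewrite divr_gt0// exprn_gt0. Qed.

(** The martingale part and the accumulated squared steps. The half-step of
    index [k.+1] involves the oracle output of index [k], hence the additional
    first term of the latter. *)
Definition mart_sum k w : R := \sum_(0 <= j < k) 2 * step j.+1 * mart j.+1 w.
Definition sqr_sum k w : R := 2 * step k.+1 ^+ 2 * gsq k w +
  \sum_(0 <= j < k) 2 * step j.+1 ^+ 2 * (gsq j.+1 w + gsq j w).
(** The quantity that controls the exit from the neighborhood, and the event
    that it has not exceeded one up to time [k]. *)
Definition excess k w : R := (mart_sum k w / c) ^+ 2 + sqr_sum k w / c.
Definition good k : set T := [set w | forall j, (j <= k)%N -> excess j w <= 1].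

Lemma mart_sumS k w : mart_sum k.+1 w = mart_sum k w + 2 * step k.+1 * mart k.+1 w.
Proof. by rewrite /mart_sum big_nat_recr. Qed.

Lemma sqr_sum_ge0 k w : 0 <= sqr_sum k w.
Proof.
have h j : 0 <= 2 * step j.+1 ^+ 2 by rewrite mulr_ge0// sqr_ge0.
by rewrite addr_ge0 ?sumr_ge0// => [|j _]; rewrite mulr_ge0// ?addr_ge0 ?gsq_ge0.
Qed.

Lemma sqr_sumS_le k w :
  sqr_sum k.+1 w <= sqr_sum k w + 4 * step k.+1 ^+ 2 * gsq k.+1 w.
Proof.
rewrite /sqr_sum big_nat_recr//=.
have h : step k.+2 ^+ 2 <= step k.+1 ^+ 2 by rewrite lerXn2r ?nnegrE.
have := mulr_ge0 (gsq_ge0 k.+1 w) (eqbRL (subr_ge0 _ _) h); lra.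
Qed.

Lemma excess_ge0 k w : 0 <= excess k w.
Proof.
by rewrite addr_ge0 ?sqr_ge0// divr_ge0 ?sqr_sum_ge0// ltW// c_gt0.
Qed.

Lemma sqd_le_sums k w : stay k w ->
  sqd k.+1 w + mart_sum k w + 2 * step k.+1 ^+ 2 * gsq k w <= sqd 1 w + sqr_sum k w.
Proof.
elim: k => [|k IH] Sw.
  by rewrite /mart_sum /sqr_sum !big_geq// !addr0.
have := sqd_step Sw (step_ge0 k) (step_small k).
have := IH (staySub (leqnSn k) Sw).
rewrite mart_sumS /sqr_sum big_nat_recr//=.
have := mulr_ge0 (mulr_ge0 (ltW a0) (step_ge0 k)) (sqd_ge0 k.+1 w); lra.
Qed.

Lemma excess_le1_near k w : stay k w -> excess k w <= 1 -> near_ball (Xh k.+1 w).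
Proof.
move=> Sw e1; have c0 := c_gt0.
have R0 := sqr_sum_ge0 k w.
have R1 : sqr_sum k w <= c.
  rewrite -[leRHS]mul1r -ler_pdivrMr//; apply: le_trans e1.
  by rewrite lerDr sqr_ge0.
have Q1 : `|mart_sum k w| <= c.
  rewrite -[leRHS]mul1r -ler_pdivrMr// -[c]gtr0_norm// -normfV -normrM.
  rewrite -ler_sqr ?nnegrE// real_normK ?num_real// expr1n; apply: le_trans e1.
  by rewrite lerDl divr_ge0// ltW.
split; first exact: Xh_in.
apply: (le_trans (half_step_le Sw)).
have := sqd_le_sums Sw; have := init1 w; rewrite -/c => h1 h2.
have cE : r ^+ 2 = 8 * c by rewrite /c; field.
move: Q1; rewrite ler_norml => /andP[Q1 _].
have := mulr_ge0 (sqr_ge0 (step k.+1)) (gsq_ge0 k w).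
rewrite cE; lra.
Qed.

Lemma good_stay k : good k `<=` stay k.+1.
Proof.
elim: k => [|k IH] w gw; apply: staySP.
- by rewrite stay0.
- by apply: excess_le1_near; [rewrite stay0|exact: gw].
- by apply: IH => j jk; apply: gw; exact: leqW.
- apply: excess_le1_near; last exact: gw.
  by apply: IH => j jk; apply: gw; exact: leqW.
Qed.

Lemma goodS k : good k.+1 `<=` good k.
Proof. by move=> w gw j jk; apply: gw; exact: leqW. Qed.

Lemma mart_sum_adapted k : adapted (hist_gen k.+1) (mart_sum k).
Proof.
elim: k => [|k IH].
  have -> : mart_sum 0 = cst 0 by apply/funext => w; rewrite /mart_sum big_geq.
  exact: measurable_cst.
have -> : mart_sum k.+1 = fun w => mart_sum k w + 2 * step k.+1 * mart k.+1 w.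
  by apply/funext => w; rewrite mart_sumS.
apply: measurable_funD; first exact: (adaptedS (leqnSn _) IH).
by apply: measurable_funM; [exact: measurable_cst|exact: mart_adapted].
Qed.

Lemma sqr_sum_adapted k : adapted (hist_gen k.+1) (sqr_sum k).
Proof.
apply: measurable_funD.
  by apply: measurable_funM; [exact: measurable_cst|exact: gsq_adapted].
suff : adapted (hist_gen k.+1)
  (fun w => \sum_(0 <= j < k) 2 * step j.+1 ^+ 2 * (gsq j.+1 w + gsq j w)) by [].
elim: k => [|k IH].
  rewrite (_ : (fun _ => _) = cst 0); first exact: measurable_cst.
  by apply/funext => w; rewrite big_geq.
rewrite (_ : (fun _ => _) = fun w =>
    \sum_(0 <= j < k) 2 * step j.+1 ^+ 2 * (gsq j.+1 w + gsq j w) +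
    2 * step k.+1 ^+ 2 * (gsq k.+1 w + gsq k w)); last first.
  by apply/funext => w; rewrite big_nat_recr.
apply: measurable_funD; first exact: (adaptedS (leqnSn _) IH).
apply: measurable_funM; first exact: measurable_cst.
apply: measurable_funD; first exact: gsq_adapted.
exact: (adaptedS (leqnSn _) (@gsq_adapted k)).
Qed.

Lemma excess_adapted k : adapted (hist_gen k.+1) (excess k).
Proof.
apply: measurable_funD.
  apply: measurable_funX; apply: measurable_funM; last exact: measurable_cst.
  exact: mart_sum_adapted.
by apply: measurable_funM; [exact: sqr_sum_adapted|exact: measurable_cst].
Qed.

Lemma good_hist k : <<s hist_gen k.+1 >> (good k).
Proof.
have -> : good k = \bigcap_(j in `I_k.+1) [set w | excess j w <= 1] by [].
apply: (@fin_bigcap_measurable _ (g_sigma_algebraType (hist_gen k.+1))) => // j /= jk.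
have := adaptedS (jk : (j.+1 <= k.+1)%N) (@excess_adapted j) measurableT
  (measurable_itv `]-oo, 1]).
by congr measurable; apply/seteqP; split => w /=; rewrite in_itv//= => -[].
Qed.

Lemma measurable_good k : measurable (good k).
Proof. exact (generated_measurable (@hist_gen_measurable k.+1) (@good_hist k)). Qed.

(* bound on the expected increase of the excess, per squared step *)
Let kappa : R := 4 * (r ^+ 2 * sigma ^+ 2) / c ^+ 2 + 4 * (M ^+ 2 + sigma ^+ 2) / c.

(** The excess, replaced by one from its first passage above one onwards. *)
Definition stopped k w : R := \1_(good k) w * excess k w + (1 - \1_(good k) w).

Lemma good_cases k w : (good k w /\ \1_(good k) w = 1 :> R) \/
  (~ good k w /\ \1_(good k) w = 0 :> R).
Proof.
by have [h|h] := pselect (good k w); [left|right];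
  rewrite indicE ?(mem_set h)// memNset.
Qed.

Lemma stopped_ge0 k w : 0 <= stopped k w.
Proof.
rewrite /stopped; have := excess_ge0 k w.
by case: (good_cases k w) => -[_ ->]; lra.
Qed.

Lemma stopped_L1 k : L1 P (stopped k).
Proof.
apply: (@L1_bounded _ _ _ P _ 1) => [|w].
  have mI : measurable_fun setT (\1_(good k) : T -> R).
    by apply: measurable_indic; exact: measurable_good.
  apply: measurable_funD; last by apply: measurable_funB => //; exact: measurable_cst.
  apply: measurable_funM => //.
  exact: (adapted_measurable (@hist_gen_measurable k.+1) (@excess_adapted k)).
rewrite ger0_norm ?stopped_ge0// /stopped.
case: (good_cases k w) => -[gw ->]; last by lra.
by have := gw k (leqnn k); lra.
Qed.

(** The term linear in [mart k.+1] has mean zero, since its other factor is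
    bounded and adapted. *)
Lemma stopped_step k w :
  stopped k.+1 w <= stopped k w +
    (4 * step k.+1 / c ^+ 2 * ((\1_(good k) w * mart_sum k w) * mart k.+1 w) +
     (4 * step k.+1 ^+ 2 / c ^+ 2 * (mart k.+1 w ^+ 2) +
      4 * step k.+1 ^+ 2 / c * gsq k.+1 w)).
Proof.
set s := step k.+1; have c0 := c_gt0.
have A0 : 0 <= 4 * s ^+ 2 / c ^+ 2 * (mart k.+1 w ^+ 2) + 4 * s ^+ 2 / c * gsq k.+1 w.
  apply: addr_ge0; apply: mulr_ge0; rewrite ?sqr_ge0 ?gsq_ge0//.
    by rewrite divr_ge0 ?sqr_ge0// mulr_ge0// sqr_ge0.
  by rewrite divr_ge0 ?(ltW c0)// mulr_ge0// sqr_ge0.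
have [[gw gE]|[ngw gE]] := good_cases k w; last first.
  have [[gw' _]|[_ gE']] := good_cases k.+1 w; first by case: ngw; exact: goodS.
  rewrite /stopped gE gE'.
  by rewrite !mul0r !subr0 !add0r mulr0 add0r lerDl.
have He : excess k.+1 w <= excess k w + (4 * s / c ^+ 2 *
     (mart_sum k w * mart k.+1 w) +
     (4 * s ^+ 2 / c ^+ 2 * (mart k.+1 w ^+ 2) + 4 * s ^+ 2 / c * gsq k.+1 w)).
  rewrite /excess mart_sumS -/s.
  have : sqr_sum k.+1 w / c <= (sqr_sum k w + 4 * s ^+ 2 * gsq k.+1 w) / c.
    by rewrite ler_wpM2r ?invr_ge0 ?(ltW c0)// sqr_sumS_le.
  move=> h; apply: (le_trans (lerD (lexx _) h)); rewrite le_eqVlt; apply/orP; left.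
  by apply/eqP; field; rewrite gt_eqF.
rewrite [stopped k w]/stopped gE !mul1r subrr addr0; apply: le_trans He.
rewrite /stopped; have [[_ ->]|[ngw' ->]] := good_cases k.+1 w; first by lra.
rewrite mul0r add0r subr0 leNgt; apply/negP => h; apply: ngw' => j.
by rewrite leq_eqVlt => /predU1P[->|]; [exact: ltW|exact: gw].
Qed.

Lemma Ex_stopped_step k :
  Ex P (stopped k.+1) <= Ex P (stopped k) + kappa * step k.+1 ^+ 2.
Proof.
have c0 := c_gt0; set s := step k.+1.
pose W w := \1_(good k) w * mart_sum k w.
have mW : adapted (hist_gen k.+1) W.
  apply: measurable_funM; last exact: mart_sum_adapted.
  by apply: adapted_indic; exact: good_hist.
have Wc w : `|W w| <= c.
  rewrite /W; case: (good_cases k w) => -[gw ->]; last by rewrite mul0r normr0 ltW.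
  rewrite mul1r -[leRHS]mul1r -ler_pdivrMr// -[X in _ / X]gtr0_norm// -normfV -normrM.
  rewrite -ler_sqr ?nnegrE// real_normK ?num_real// expr1n.
  apply: le_trans (gw k (leqnn k)).
  by rewrite lerDl divr_ge0 ?sqr_sum_ge0// ltW.
have [LW EW] := Ex_mul_mart mW Wc.
have [Lm Em] := mart_sqr k.+1.
have [Lg Eg] := Ex_gsq k.+1.
have L1' := L1Z (4 * s / c ^+ 2) LW.
have L2' := L1Z (4 * s ^+ 2 / c ^+ 2) Lm.
have L3' := L1Z (4 * s ^+ 2 / c) Lg.
have L23 := L1D L2' L3'.
have L123 := L1D L1' L23.
have Ls := stopped_L1 k.
apply: (le_trans (le_Ex (stopped_L1 k.+1) (L1D Ls L123) (stopped_step k))).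
rewrite ExD// ExD// ExD// !ExZ// EW mulr0 add0r lerD2l.
have s2 := sqr_ge0 s.
rewrite /kappa [leRHS]mulrDl; apply: lerD.
  have -> : 4 * (r ^+ 2 * sigma ^+ 2) / c ^+ 2 * s ^+ 2 =
    4 * s ^+ 2 / c ^+ 2 * (r ^+ 2 * sigma ^+ 2) by field; rewrite gt_eqF.
  by apply: ler_wpM2l => //; rewrite divr_ge0 ?sqr_ge0// mulr_ge0.
have -> : 4 * (M ^+ 2 + sigma ^+ 2) / c * s ^+ 2 =
  4 * s ^+ 2 / c * (M ^+ 2 + sigma ^+ 2) by field; rewrite gt_eqF.
by apply: ler_wpM2l => //; rewrite divr_ge0 ?(ltW c0)// mulr_ge0.
Qed.

Lemma kappa_ge0 : 0 <= kappa.
Proof.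
have c0 := c_gt0.
apply: addr_ge0; apply: divr_ge0; rewrite ?sqr_ge0 ?(ltW c0)//.
  by apply: mulr_ge0 => //; apply: mulr_ge0; exact: sqr_ge0.
by apply: mulr_ge0 => //; apply: addr_ge0; exact: sqr_ge0.
Qed.

Lemma Ex_stopped0 : Ex P (stopped 0) <= kappa * step 1 ^+ 2.
Proof.
have c0 := c_gt0; set s := step 1.
have [Lg Eg] := Ex_gsq 0.
have L := L1Z (4 * s ^+ 2 / c) Lg.
apply: (@le_trans _ _ (Ex P (fun w => 4 * s ^+ 2 / c * gsq 0 w))).
  apply: le_Ex => //; first exact: stopped_L1.
  move=> w; have eE : excess 0 w = 2 * s ^+ 2 / c * gsq 0 w.
    rewrite /excess /mart_sum /sqr_sum !big_geq// mul0r expr0n/= add0r addr0 -/s.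
    by field; rewrite gt_eqF.
  have k0 : 0 <= s ^+ 2 / c * gsq 0 w.
    by rewrite mulr_ge0 ?gsq_ge0// divr_ge0 ?sqr_ge0// ltW.
  rewrite /stopped; case: (good_cases 0 w) => -[gw ->].
    by rewrite eE; lra.
  rewrite mul0r add0r subr0 leNgt; apply/negP => h; apply: gw => j.
  by rewrite leqn0 => /eqP ->; rewrite eE; lra.
rewrite ExZ//.
have h : 4 * s ^+ 2 / c * Ex P (gsq 0) <= 4 * s ^+ 2 / c * (M ^+ 2 + sigma ^+ 2).
  by apply: ler_wpM2l => //; rewrite divr_ge0 ?(ltW c0)// mulr_ge0// sqr_ge0.
apply: (le_trans h).
have -> : 4 * s ^+ 2 / c * (M ^+ 2 + sigma ^+ 2) =
  4 * (M ^+ 2 + sigma ^+ 2) / c * s ^+ 2 by field; rewrite gt_eqF.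
rewrite ler_wpM2r ?sqr_ge0// lerDr.
apply: divr_ge0; rewrite ?sqr_ge0//; apply: mulr_ge0 => //.
by apply: mulr_ge0; exact: sqr_ge0.
Qed.

(** The half-steps leave the neighborhood with a probability controlled by the
    sum of the squared steps. *)
Lemma prob_stay k :
  1 - 2 * kappa * \sum_(0 <= j < k.+1) step j.+1 ^+ 2 <= fine (P (stay k.+1)).
Proof.
have Es : Ex P (stopped k) <= kappa * (step 1 ^+ 2 + \sum_(0 <= j < k) step j.+1 ^+ 2).
  elim: k => [|k IH]; first by rewrite big_geq// addr0 Ex_stopped0.
  apply: (le_trans (Ex_stopped_step k)).
  by rewrite big_nat_recr//= addrA mulrDr lerD2r.
have LI := L1_indic P (measurable_good k).
have LS := L1_indic P (measurable_stay k.+1).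
have L1I := L1B (L1_cst P 1) LI.
have EI : 1 - Ex P (\1_(good k) : T -> R) <= Ex P (stopped k).
  rewrite -[X in X - _](Ex_cst P) -ExB//; last exact: L1_cst.
  apply: le_Ex => //; first exact: stopped_L1.
  by move=> w; rewrite /stopped lerDr mulr_ge0 ?indic_ge0 ?excess_ge0.
have IS : Ex P (\1_(good k) : T -> R) <= Ex P (\1_(stay k.+1) : T -> R).
  apply: le_Ex => // w; case: (good_cases k w) => -[gw ->]; last exact: indic_ge0.
  by rewrite indicE mem_set//; exact: good_stay.
rewrite -Ex_indic; last exact: measurable_stay.
have sq_ge0 (j : nat) : 0 <= step j.+1 ^+ 2 by exact: sqr_ge0.
have s1 : step 1 ^+ 2 <= \sum_(0 <= j < k.+1) step j.+1 ^+ 2.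
  by rewrite big_nat_recl//= lerDl sumr_ge0.
have s2 : \sum_(0 <= j < k) step j.+1 ^+ 2 <= \sum_(0 <= j < k.+1) step j.+1 ^+ 2.
  by rewrite big_nat_recr//= lerDl.
have := ler_wpM2l kappa_ge0 (lerD s1 s2); lra.
Qed.

End Stability.

(** * The mean-square recursion *)

Section Rate.
Context (step_ge0 : forall k, 0 <= step k.+1)
  (step_small : forall k, 2 * a * step k.+1 <= 1) (D1 : R)
  (init1 : forall w, sqd 1 w <= D1).

Let S : R := M ^+ 2 + sigma ^+ 2.

(** Squared distance to the solution, on the event that the half-steps have not
    left the neighborhood before. *)
Definition stopped_sqd k w : R := ind k w * sqd k.+1 w.

Lemma stopped_sqd_ge0 k w : 0 <= stopped_sqd k w.
Proof. by rewrite mulr_ge0 ?ind_ge0 ?sqd_ge0. Qed.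

Lemma stopped_sqd_measurable k : measurable_fun setT (stopped_sqd k).
Proof.
apply: measurable_funM; last exact: sqd_measurable.
exact: measurable_indic (measurable_stay k).
Qed.

Lemma stopped_sqd_step k w :
  stopped_sqd k.+1 w <= (1 - a * step k.+1) * stopped_sqd k w +
    (- (2 * step k.+1) * mart k.+1 w + 2 * step k.+1 ^+ 2 * (gsq k.+1 w + gsq k w)).
Proof.
set s := step k.+1; have s0 : 0 <= s by exact: step_ge0.
have s1 : 2 * a * s <= 1 by exact: step_small.
have as1 : 0 <= 1 - a * s by have := mulr_ge0 (ltW a0) s0; lra.
rewrite /stopped_sqd; have [[Sw ->]|[nSw nE]] := ind_cases k.+1 w.
  rewrite (ind1 (staySub (leqnSn k) Sw)) !mul1r.
  by have := sqd_step Sw s0 s1; rewrite -/s; lra.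
rewrite nE mul0r /mart nE mul0r mulr0 add0r addr_ge0//.
  by rewrite mulr_ge0 ?mulr_ge0 ?ind_ge0 ?sqd_ge0.
by rewrite mulr_ge0 ?addr_ge0 ?gsq_ge0// mulr_ge0 ?sqr_ge0.
Qed.

Lemma stopped_sqd_L1 k : L1 P (stopped_sqd k).
Proof.
elim: k => [|k IH].
  apply: (@L1_bounded _ _ _ P _ D1); first exact: stopped_sqd_measurable.
  move=> w; rewrite ger0_norm ?stopped_sqd_ge0//.
  by rewrite /stopped_sqd ind1 ?mul1r// stay0.
apply: L1_le (stopped_sqd_measurable k.+1) _
  (L1D (L1Z (1 - a * step k.+1) IH) (L1D (L1Z (- (2 * step k.+1)) (mart_mean k.+1).1)
    (L1Z (2 * step k.+1 ^+ 2) (L1D (Ex_gsq k.+1).1 (Ex_gsq k).1)))).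
by move=> w; rewrite ger0_norm ?stopped_sqd_ge0//; exact: stopped_sqd_step.
Qed.

Lemma Ex_stopped_sqd_step k :
  Ex P (stopped_sqd k.+1) <=
    (1 - a * step k.+1) * Ex P (stopped_sqd k) + 4 * step k.+1 ^+ 2 * S.
Proof.
have [Lm Em] := mart_mean k.+1.
have [Lg Eg] := Ex_gsq k.+1.
have [Lg' Eg'] := Ex_gsq k.
have LD := stopped_sqd_L1 k.
have K1 := L1Z (1 - a * step k.+1) LD.
have K2 := L1Z (- (2 * step k.+1)) Lm.
have K3 := L1D Lg Lg'.
have K4 := L1Z (2 * step k.+1 ^+ 2) K3.
have K5 := L1D K2 K4.
apply: (le_trans (le_Ex (stopped_sqd_L1 k.+1) (L1D K1 K5) (stopped_sqd_step k))).
rewrite ExD// ExZ// lerD2l ExD// ExZ// Em mulr0 add0r ExZ// ExD//.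
have -> : 4 * step k.+1 ^+ 2 * S = 2 * step k.+1 ^+ 2 * (S + S) by ring.
by apply: ler_wpM2l; [rewrite mulr_ge0// sqr_ge0|exact: lerD].
Qed.

End Rate.

(** * The event that the half-steps never leave the neighborhood *)

Section StayForever.

Definition stay_forever : set T := [set w | forall t, (0 < t)%N -> near_ball (Xh t w)].

Lemma stay_foreverE : stay_forever = \bigcap_k stay k.
Proof.
apply/seteqP; split => w h.
  by move=> k _ [|s] _; [exact: init|exact: h].
by move=> t t0; exact: (h t I t (leqnn t)).
Qed.

Lemma measurable_stay_forever : measurable stay_forever.
Proof.
by rewrite stay_foreverE; apply: bigcap_measurableType => k _; exact: measurable_stay.
Qed.

Lemma prob_stay_forever x : (forall k, x <= fine (P (stay k.+1))) ->
  (x%:E <= P stay_forever)%E.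
Proof.
move=> hx.
have h : P \o stay @ \oo --> P stay_forever.
  rewrite stay_foreverE; apply: nonincreasing_cvg_mu.
  - by apply: (le_lt_trans (probability_le1 P (measurable_stay 0))); rewrite ltry.
  - exact: measurable_stay.
  - by rewrite -stay_foreverE; exact: measurable_stay_forever.
  - by move=> m n mn; apply/subsetPset; exact: staySub.
apply: cvge_ge h; exists 1%N => // -[//|k] _ /=.
rewrite -(@fineK _ (P (stay k.+1))) ?lee_fin//.
exact: fin_num_measure (measurable_stay k.+1).
Qed.

Lemma exp_given_stay_le k (delta : R) : delta < 1 -> L1 P (stopped_sqd k) ->
  ((1 - delta)%:E <= P stay_forever)%E ->
  (exp_given_event P stay_forever (fun w => (enorm (Xs k.+1 w - xs) ^+ 2)%R)
    <= (Ex P (stopped_sqd k) / (1 - delta))%:E)%E.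
Proof.
move=> d1 LD hP.
have d0 : 0 < 1 - delta by rewrite subr_gt0.
have fP : P stay_forever \is a fin_num by exact: fin_num_measure measurable_stay_forever.
have q0 : 1 - delta <= fine (P stay_forever) by rewrite -lee_fin fineK.
have hI : (\int[P]_(w in stay_forever) ((enorm (Xs k.+1 w - xs) ^+ 2)%R)%:E <=
    (Ex P (stopped_sqd k))%:E)%E.
  have -> : (\int[P]_(w in stay_forever) ((enorm (Xs k.+1 w - xs) ^+ 2)%R)%:E =
      \int[P]_(w in stay_forever) (stopped_sqd k w)%:E)%E.
    apply: eq_integral => w /set_mem hw; have : stay_forever w by [].
    rewrite stay_foreverE => /(_ k I) Sw.
    by rewrite enorm_sqr /stopped_sqd (ind1 Sw) mul1r.
  rewrite /Ex /Rintegral fineK; last exact: integrable_fin_num.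
  apply: ge0_subset_integral => //.
  - exact: measurable_stay_forever.
  - by apply/measurable_EFinP; exact: stopped_sqd_measurable.
  - by move=> w _; rewrite lee_fin stopped_sqd_ge0.
rewrite /exp_given_event -(fineK fP) inver gt_eqF ?(lt_le_trans d0)//.
rewrite lee_pdivrMr ?(lt_le_trans d0)//; apply: (le_trans hI).
rewrite -EFinM lee_fin mulrAC ler_pdivlMr//.
by apply: ler_wpM2l => //; apply: Ex_ge0 => w; exact: stopped_sqd_ge0.
Qed.

End StayForever.

End Process.

(** * Local convergence *)

(** Both conclusions on a neighborhood where the field is bounded by [M] and
    strongly monotone with modulus [a] with respect to the solution. *)
Lemma peg_local (R : realType) (d : nat) (X : set 'rV[R]_d)
    (V : 'rV[R]_d -> 'rV[R]_d) (xs : 'rV[R]_d) (r a M delta gamma sigma : R) :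
  convex_set (X : set (convex_lmodType 'rV[R]_d)) -> X xs ->
  0 < r -> 0 < a -> 0 <= M ->
  (forall x, near_ball X xs r x -> {for x, continuous V}) ->
  (forall x, near_ball X xs r x -> dotv (V x) (V x) <= M ^+ 2) ->
  (forall x, near_ball X xs r x ->
     a * dotv (x - xs) (x - xs) <= dotv (V x) (x - xs)) ->
  0 < delta -> delta < 1 -> 0 < gamma ->
  exists b0 : R, forall b : R, b0 <= b ->
  forall (disp : measure_display) (T : measurableType disp)
    (P : probability T R) (Xh Xs G Z : nat -> T -> 'rV[R]_d),
    stochastic_oracle P V sigma Xh Xs G Z ->
    (forall w, PEG X (fun t => gamma / (t%:R + b)) (Xh ^~ w) (Xs ^~ w) (G ^~ w)) ->
    (forall w, near_ball X xs r (Xh 0%N w) /\ near_ball X xs (r / 3) (Xs 1%N w)) ->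
    let Einf := stay_forever X xs r Xh in
    [/\ measurable Einf, ((1 - delta)%:E <= P Einf)%E &
      1 < a * gamma ->
      exists2 rem : nat -> R, rem =o_\oo (fun t : nat => (t%:R)^-1 : R) &
      forall t, (0 < t)%N ->
        (exp_given_event P Einf (fun w => (enorm (Xs t w - xs) ^+ 2)%R) <=
         (4 * gamma ^+ 2 * (M ^+ 2 + sigma ^+ 2) /
            ((a * gamma - 1) * (1 - delta)) / t%:R + rem t)%:E)%E].
Proof.
move=> Xcv Xxs r0 a0 M0 Vc Vb Va delta0 delta1 gamma0.
pose kappa := 4 * (r ^+ 2 * sigma ^+ 2) / (r ^+ 2 / 8) ^+ 2 +
         4 * (M ^+ 2 + sigma ^+ 2) / (r ^+ 2 / 8).
have r2 : 0 < r ^+ 2 by rewrite exprn_gt0.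
have kappa0 : 0 <= kappa.
  apply: addr_ge0; apply: divr_ge0; rewrite ?sqr_ge0//.
  - by apply: mulr_ge0 => //; apply: mulr_ge0; exact: sqr_ge0.
  - by apply: mulr_ge0 => //; apply: addr_ge0; exact: sqr_ge0.
  - by rewrite divr_ge0// ltW.
have ag0 : 0 < a * gamma by rewrite mulr_gt0.
have K0 : 0 <= 2 * kappa * gamma ^+ 2 / delta.
  by apply: divr_ge0 (ltW delta0); apply: mulr_ge0 (sqr_ge0 _); exact: mulr_ge0.
(* the first two terms give 2 a g_t <= 1 and the condition of Chung's lemma on b;
   the last one makes the exit probability at most delta *)
exists (1 + 2 * a * gamma + 2 * kappa * gamma ^+ 2 / delta) => b hb.
move=> disp T P Xh Xs G Z oracle peg init Einf.
have b1 : 1 <= b by lra.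
have b0 : 0 < b by lra.
have tb t : 0 < t%:R + b by have t0 : 0 <= t%:R :> R by []; lra.
pose step (t : nat) := gamma / (t%:R + b).
have initX w : near_ball X xs r (Xh 0%N w) by have [] := init w.
have D1 w : sqd xs Xs 1 w <= r ^+ 2 / 8.
  (* (r / 3)^2 <= r^2 / 8 *)
  by have [_ [_]] := init w; rewrite /sqd expr_div_n; lra.
have step_ge0 k : 0 <= step k.+1 by rewrite divr_ge0 ?ltW.
have step_dec k : step k.+2 <= step k.+1.
  by rewrite ler_pM2l// lef_pV2 ?posrE// lerD2r ler_nat.
have step_small k : 2 * a * step k.+1 <= 1.
  rewrite /step mulrA ler_pdivrMr// mul1r.
  by have t0 : 0 <= k.+1%:R :> R by []; lra.
have mE : measurable Einf by exact: (measurable_stay_forever Xcv oracle peg initX).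
have PE : ((1 - delta)%:E <= P Einf)%E.
  apply: (prob_stay_forever Xcv oracle peg initX) => k.
  apply: le_trans (prob_stay Xcv Xxs r0 a0 M0 Vc Vb Va oracle peg initX
    step_ge0 step_dec step_small D1 k).
  rewrite lerD2l lerN2 -/kappa -/(step _).
  have -> : \sum_(0 <= j < k.+1) (gamma / (j.+1%:R + b)) ^+ 2 =
      gamma ^+ 2 * \sum_(0 <= j < k.+1) (j.+1%:R + b) ^- 2.
    by rewrite mulr_sumr; apply: eq_bigr => j _; rewrite expr_div_n.
  rewrite mulrA; have kg : 0 <= 2 * kappa * gamma ^+ 2.
    by apply: mulr_ge0 (sqr_ge0 _); exact: mulr_ge0.
  apply: (le_trans (ler_wpM2l kg (sum_sqr_step_le k.+1 b0))).
  by rewrite ler_pdivrMr// -ler_pdivrMl// mulrC; lra.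
split => // ag1.
pose S := M ^+ 2 + sigma ^+ 2.
have S0 : 0 <= S by rewrite addr_ge0 ?sqr_ge0.
(* the iterate of index t is controlled on the event of index t - 1 *)
pose A t := Ex P (stopped_sqd X xs r Xh Xs t.-1).
have LA k : L1 P (stopped_sqd X xs r Xh Xs k).
  exact: (stopped_sqd_L1 Xcv Xxs r0 a0 M0 Vc Vb Va oracle peg initX step_ge0 step_small D1).
have [|||rem hrem hA] := @chung R A b (a * gamma) (4 * gamma ^+ 2 * S) ag1.
- by rewrite mulr_ge0// mulr_ge0// sqr_ge0.
- by lra.
- case=> // t _; have := Ex_stopped_sqd_step Xcv Xxs r0 a0 M0 Vc Vb Va oracle peg
    initX step_ge0 step_small D1 t.
  by rewrite /A /= expr_div_n -/S !mulrA (mulrAC _ _ S).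
have d0 : 0 < 1 - delta by rewrite subr_gt0.
exists (fun t => rem t / (1 - delta)).
  move/eqoP : hrem => hrem; apply/eqoP => e e0.
  apply: filterS (hrem (e * (1 - delta)) (mulr_gt0 e0 d0)) => t ht.
  by rewrite normrM normfV (gtr0_norm d0) ler_pdivrMr// mulrAC.
case=> // k _.
apply: (le_trans (exp_given_stay_le Xcv oracle peg initX delta1 (LA k) PE)).
rewrite lee_fin.
have -> : 4 * gamma ^+ 2 * S / ((a * gamma - 1) * (1 - delta)) / k.+1%:R +
    rem k.+1 / (1 - delta) =
  (4 * gamma ^+ 2 * S / (a * gamma - 1) / k.+1%:R + rem k.+1) / (1 - delta).
  by field; rewrite !gt_eqF ?subr_gt0 ?ltr0n.
by rewrite ler_pM2r ?invr_gt0//; apply: (hA k.+1).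
Qed.

(** The dimension enters because neighborhoods are those of the max norm. *)
Lemma near_ball_nbhd (R : realType) (d : nat) (X : set 'rV[R]_d) (xs : 'rV[R]_d) (r : R) :
  0 < r -> nbhd_in X xs (near_ball X xs r).
Proof.
move=> r0; split => [x []//|].
have d0 : 0 <= d%:R :> R by [].
have e0 : 0 < r / (d%:R + 1) by rewrite divr_gt0//; lra.
apply/nbhs_ballP; exists (r / (d%:R + 1)) => //= x.
rewrite -ball_normE /= distrC => hx Xx; split => //.
apply: (le_trans (dotv_le_mxnorm _)).
have : `|x - xs| ^+ 2 <= (r / (d%:R + 1)) ^+ 2 by rewrite lerXn2r ?nnegrE// ltW.
rewrite expr_div_n ler_pdivlMr; last by rewrite exprn_gt0//; lra.
move=> h; apply: le_trans h; rewrite mulrC ler_wpM2l ?sqr_ge0//; nra.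
Qed.

(** If the curvature is infinite, then the neighborhood and, by convexity, the
    whole constraint set reduce to the solution. *)
Lemma curvature_pinfty (R : realType) (d : nat) (X : set 'rV[R]_d)
    (V : 'rV[R]_d -> 'rV[R]_d) (xs : 'rV[R]_d) (r : R) :
  convex_set (X : set (convex_lmodType 'rV[R]_d)) -> X xs -> 0 < r ->
  inf_curvature V (near_ball X xs r) xs = +oo%E -> forall x, X x -> x = xs.
Proof.
move=> Xcv Xxs r0 hoo x Xx; apply/eqP; apply: contraT => xN.
set N := dotv (x - xs) (x - xs).
have N0 : 0 < N by rewrite lt0r dotv_ge0 dotv_eq0 subr_eq0 xN.
pose t := Num.min 1 (r ^+ 2 / N).
have t0 : 0 < t by rewrite lt_min ltr01 divr_gt0// exprn_gt0.
have t1 : t <= 1 by rewrite ge_min lexx.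
have tN : t * N <= r ^+ 2 by rewrite -ler_pdivlMr// ge_min lexx orbT.
pose y := t *: x + (1 - t) *: xs.
(* y is a point of the neighborhood on the segment from xs to x *)
have yE : y - xs = t *: (x - xs) by apply/rowP => i; rewrite !mxE; ring.
have Uy : near_ball X xs r y.
  split; first by apply: convex_set_segment => //; exact: ltW.
  rewrite yE dotvZl dotvZr -/N; apply: le_trans tN.
  by rewrite ger_pMl// mulr_gt0.
have yN : y != xs by rewrite -subr_eq0 yE scaler_eq0 negb_or gt_eqF//= subr_eq0.
have := ereal_inf_lbound (S := [set (dotv (V x) (x - xs) / enorm (x - xs) ^+ 2)%:E
            | x in [set x | near_ball X xs r x /\ x != xs]]).
move/(_ _ (ex_intro2 _ _ y (conj Uy yN) erefl)).
by rewrite -/(inf_curvature V (near_ball X xs r) xs) hoo leye_eq.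
Qed.

Theorem theorem6 (R : realType) (d : nat)
    (X : set 'rV[R]_d) (X0 : X !=set0) (Xcl : closed X)
    (Xcv : convex_set (X : set (convex_lmodType 'rV[R]_d)))
    (V : 'rV[R]_d -> 'rV[R]_d) (xs : 'rV[R]_d)
    (xsreg : regular_solution X V xs) :
  exists U U1 : set 'rV[R]_d,
    let M := sup_norm_on V U in
    let alpha := inf_curvature V U xs in
    [/\ nbhd_in X xs U, nbhd_in X xs U1, (M < +oo)%E, (0 < alpha)%E &
    forall (delta gamma sigma : R),
      0 < delta -> delta < 1 -> (alpha^-1 < gamma%:E)%E -> 0 <= sigma ->
    exists b0 : R, forall b : R, b0 <= b ->
    forall (disp : measure_display) (T : measurableType disp)
      (P : probability T R) (Xh Xs G Z : nat -> T -> 'rV[R]_d),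
      stochastic_oracle P V sigma Xh Xs G Z ->
      (forall w, PEG X (fun t => gamma / (t%:R + b))
                   (Xh ^~ w) (Xs ^~ w) (G ^~ w)) ->
      (forall w, U (Xh 0%N w) /\ U1 (Xs 1%N w)) ->
      let Einf := [set w | forall t, (0 < t)%N -> U (Xh t w)] in
      [/\ measurable Einf, ((1 - delta)%:E <= P Einf)%E &
          exists2 r : nat -> R, r =o_\oo (fun t : nat => (t%:R)^-1 : R) &
            forall t, (0 < t)%N ->
              (exp_given_event P Einf (fun w => (enorm (Xs t w - xs) ^+ 2)%R)
               <= (4 * gamma ^+ 2)%:E * (M ^+ 2 + (sigma ^+ 2)%:E)
                    / ((alpha * gamma%:E - 1) * (1 - delta)%:E)
                    * (t%:R^-1)%:E
                  + (r t)%:E)%E]].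
Proof.
have [[Xxs _] _ _] := xsreg.
have [r [a0 [K [r0 a0_gt0 hr]]]] := regular_local xsreg.
pose U := near_ball X xs r; exists U, (near_ball X xs (r / 3)) => M alpha.
have r3 : 0 < r / 3 by rewrite divr_gt0.
have Uxs : U xs.
  by split; rewrite // subrr dotv0 sqr_ge0.
have Mle : (M <= K%:E)%E.
  by apply: ge_ereal_sup => _ [x [Xx xr] <-]; rewrite lee_fin; have [] := hr x Xx xr.
have Mge x : U x -> ((enorm (V x))%:E <= M)%E.
  by move=> Ux; apply: ereal_sup_ubound; exists x.
have M0 : (0 <= M)%E by apply: (le_trans _ (Mge _ Uxs)); rewrite lee_fin enorm_ge0.
have Moo : (M < +oo)%E by exact: le_lt_trans Mle (ltry K).
have sqd_gt0 x : x != xs -> 0 < enorm (x - xs) ^+ 2.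
  by move=> xN; rewrite enorm_sqr lt0r dotv_ge0 dotv_eq0 subr_eq0 xN.
have alpha_ge : (a0%:E <= alpha)%E.
  apply: le_ereal_inf_tmp => _ [x [[Xx xr] xN] <-].
  by rewrite lee_fin ler_pdivlMr ?sqd_gt0// enorm_sqr; have [] := hr x Xx xr.
have alpha0 : (0 < alpha)%E by apply: lt_le_trans alpha_ge; rewrite lte_fin.
split => //; [exact: near_ball_nbhd|exact: near_ball_nbhd|].
move=> delta gamma sigma delta0 delta1 gammaP sigma0.
have gamma0 : 0 < gamma.
  by rewrite -lte_fin (le_lt_trans _ gammaP)// inve_ge0 ltW.
have [m mE] : exists m, M = m%:E by exists (fine M); rewrite fineK// ge0_fin_numE.
have m0 : 0 <= m by rewrite -lee_fin -mE.
have Vc x : U x -> {for x, continuous V} by move=> [Xx xr]; have [] := hr x Xx xr.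
have Vb x : U x -> dotv (V x) (V x) <= m ^+ 2.
  move=> /Mge; rewrite mE lee_fin => h.
  by rewrite -enorm_sqr lerXn2r ?nnegrE ?enorm_ge0.
have Va0 x : U x -> a0 * dotv (x - xs) (x - xs) <= dotv (V x) (x - xs).
  by move=> [Xx xr]; have [] := hr x Xx xr.
have [[al alE]|aloo] : (exists al, alpha = al%:E) \/ alpha = +oo%E.
  by case: (alpha) alpha0 => [al| |] //; [left; exists al|right].
- have al0 : 0 < al by rewrite -lte_fin -alE.
  have Va x : U x -> al * dotv (x - xs) (x - xs) <= dotv (V x) (x - xs).
    move=> Ux; have [->|xN] := eqVneq x xs.
      by rewrite subrr !dotv0 mulr0.
    rewrite -enorm_sqr -ler_pdivlMr ?sqd_gt0// -lee_fin -alE.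
    by apply: ereal_inf_lbound; exists x.
  have ag : 1 < al * gamma.
    by move: gammaP; rewrite alE inver gt_eqF// lte_fin mulrC -ltr_pdivrMr// div1r.
  have [b0 hb0] := peg_local sigma Xcv Xxs r0 al0 m0 Vc Vb Va delta0 delta1 gamma0.
  exists b0 => b b0b disp T P Xh Xs G Z oracle peg init Einf.
  have [mEinf PE /(_ ag)[rem hrem hE]] := hb0 b b0b disp T P Xh Xs G Z oracle peg init.
  split => //; exists rem => // t t0.
  apply: (le_trans (hE t t0)).
  rewrite alE mE -EFin_expe -EFinD -!EFinM.
  rewrite inver gt_eqF; last first.
    by rewrite mulr_gt0 ?subr_gt0.
  by rewrite -!EFinM -EFinD lee_fin.
(* the distance to xs vanishes identically, and so does the bound *)
- have Xsing := curvature_pinfty Xcv Xxs r0 aloo.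
  have [b0 hb0] := peg_local sigma Xcv Xxs r0 a0_gt0 m0 Vc Vb Va0 delta0 delta1 gamma0.
  exists b0 => b b0b disp T P Xh Xs G Z oracle peg init Einf.
  have [mEinf PE _] := hb0 b b0b disp T P Xh Xs G Z oracle peg init.
  split => //; exists (fun=> 0).
    by apply/eqoP => e e0; near=> t; rewrite normr0 mulr_ge0// ltW.
  move=> t t0.
  have -> : exp_given_event P Einf (fun w => (enorm (Xs t w - xs) ^+ 2)%R) = 0%E.
    rewrite /exp_given_event integral0_eq ?mul0e// => w _.
    have XXs : X (Xs t w).
      by case: t t0 => // t _; exact: Xs_in peg t w.
    by rewrite (Xsing _ XXs) subrr enorm_sqr dotv0.
  rewrite adde0 aloo gt0_mulye ?lte_fin// addye// gt0_mulye ?lte_fin ?subr_gt0// invey.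
  by rewrite mule0 mul0e.
Unshelve. all: by end_near.
Qed.
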